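(* Let $X$ be an infinite-dimensional complex Banach space and $T\in L(X)$. (i) If $T$ has the SVEP, then all accumulation points of $\sigma_{B\mathcal B_+}(T)$ belong to $\sigma_{\mathbf{gK}\mathcal M}(T)$. (ii) If $T'$ has the SVEP, then all accumulation points of $\sigma_{B\mathcal B_-}(T)$ belong to $\sigma_{\mathbf{gK}\mathcal M}(T)$. (iii) If $T$ and $T'$ have the SVEP, then all accumulation points of $\sigma_{B\mathcal B}(T)$ belong to $\sigma_{\mathbf{gK}\mathcal M}(T)$.
   Context: $L(X)$ is the algebra of bounded linear operators on $X$; $T'$ is the dual (adjoint) operator on $X'$; $N(T)$, $R(T)$ are kernel and range. An operator $S$ on a Banach space $Y$ has the SVEP (single-valued extension property) at $\lambda_0\in\mathbb C$ if for every open disc $\mathcal D_{\lambda_0}$ centered at $\lambda_0$ the only analytic function $f:\mathcal D_{\lambda_0}\to Y$ satisfying $(S-\lambda)f(\lambda)=0$ for all $\lambda\in\mathcal D_{\lambda_0}$ is $f\equiv 0$; $S$ has the SVEP if it has the SVEP at every $\lambda_0\in\mathbb C$. $(M,N)\in Red(T)$ means that $M,N$ are closed $T$-invariant subspaces with $X=M\oplus N$; $T_M$, $T_N$ are the restrictions of $T$ viewed as operators on $M$, $N$. $T$ is Kato if $R(T)$ is closed and $N(T)\subset R(T^n)$ for every $n\in\mathbb N$. An operator is meromorphic if every non-zero point of its spectrum is a pole of its resolvent. $T$ admits a generalized Kato-meromorphic decomposition if there is $(M,N)\in Red(T)$ with $T_M$ Kato and $T_N$ meromorphic. $\sigma_{\mathbf{gK}\mathcal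 M}(T)=\{\lambda\in\mathbb C:T-\lambda I\text{ does not admit a generalized Kato-meromorphic decomposition}\}$. Upper semi-Browder: upper semi-Fredholm (finite-dimensional kernel, closed range) with finite ascent. Lower semi-Browder: lower semi-Fredholm (range of finite codimension) with finite descent. Browder: both upper and lower semi-Browder. $T$ is upper semi-B-Browder (lower semi-B-Browder, B-Browder) if there is an integer $n\ge0$ such that $R(T^n)$ is closed and the restriction of $T$ to $R(T^n)$, viewed as a map $R(T^n)\to R(T^n)$, is upper semi-Browder (lower semi-Browder, Browder); it is known that these classes are the left Drazin invertible (ascent $a(T)<\infty$ and $R(T^{a(T)+1})$ closed), right Drazin invertible (descent $\delta(T)<\infty$ and $R(T^{\delta(T)})$ closed) and Drazin invertible (finite ascent and descent) operators. $\sigma_{B\mathcal B_+}(T)$, $\sigma_{B\mathcal B_-}(T)$, $\sigma_{B\mathcal B}(T)$ are the sets of $\lambda\in\mathbb C$ such that $T-\lambda I$ is not upper semi-B-Browder, not lower semi-B-Browder, not B-Browder, respectively. *)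

(* Defs.v *)
From HB Require Import structures.
From mathcomp Require Import all_boot all_order all_algebra.
From mathcomp Require Import all_classical all_reals all_analysis.
From mathcomp Require Import complex.

Set Implicit Arguments.
Unset Strict Implicit.
Unset Printing Implicit Defensive.

Import Order.TTheory GRing.Theory Num.Theory.
Import numFieldNormedType.Exports.

Local Open Scope classical_set_scope.
Local Open Scope ring_scope.

(* The complex field as a normed space over itself: the norm topology is
   canonical on the regular module [R[i]^o], not on [R[i]]. *)
Notation Cplx R := (R[i]^o).

Section BoundedOp.
Context {R : realType} (U V : normedModType R[i]).

Definition is_bounded_op : {pred U -> V} :=
  fun f => `[< linear f /\ continuous f >].

Record boundedOp := BoundedOp {
  bop_fun :> U -> V;
  bop_funP : bop_fun \in is_bounded_op }.

HB.instance Definition _ := [isSub for bop_fun].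
HB.instance Definition _ := [Choice of boundedOp by <:].

Lemma bounded_opP (f : U -> V) :
  reflect (linear f /\ continuous f) (f \in is_bounded_op).
Proof. exact: asboolP. Qed.

Fact bounded_op_submod_closed : submod_closed is_bounded_op.
Proof.
split.
  apply/bounded_opP; split; first by move=> a x y /=; rewrite scaler0 addr0.
  exact: cst_continuous.
move=> a f g /bounded_opP[lf cf] /bounded_opP[lg cg].
apply/bounded_opP; split.
  move=> b x y; rewrite !fctE lf lg !scalerDr !scalerA (mulrC a b).
  by rewrite -!addrA; congr (_ + _); rewrite addrCA.
move=> x; apply: (@continuousD _ _ _ (a *: f) g); last exact: cg.
by apply: continuousZr; exact: cf.
Qed.
HB.instance Definition _ :=
  GRing.isSubmodClosed.Build R[i] (U -> V) is_bounded_op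
    bounded_op_submod_closed.
HB.instance Definition _ := [SubChoice_isSubLmodule of boundedOp by <:].

Fact bop_is_linear (f : boundedOp) : linear f.
Proof. by case/bounded_opP: (bop_funP f). Qed.
HB.instance Definition _ (f : boundedOp) :=
  GRing.isLinear.Build R[i] U V *:%R f (bop_is_linear f).

Lemma bop_continuous (f : boundedOp) : continuous f.
Proof. by case/bounded_opP: (bop_funP f). Qed.

Lemma boundedOpP (f g : boundedOp) : f =1 g -> f = g.
Proof. by move=> fg; apply/val_inj/funext. Qed.

Lemma add_bopE (f g : boundedOp) x : (f + g) x = f x + g x. Proof. by []. Qed.
Lemma opp_bopE (f : boundedOp) x : (- f) x = - f x. Proof. by []. Qed.
Lemma scale_bopE a (f : boundedOp) x : (a *: f) x = a *: f x.
Proof. by []. Qed.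

(* Norms over [R[i]] take their values in the nonnegative reals of [R[i]];
   the supremum is taken in [R] and injected back. *)
Definition opnorm (f : boundedOp) : R[i] :=
  (sup [set complex.Re `|f x| | x in [set x | `|x| <= 1]])%:C%C.

Let normRe (W : normedModType R[i]) (x : W) : (complex.Re `|x|)%:C%C = `|x|.
Proof. by rewrite RRe_real// normr_real. Qed.

Let opnorm_has_sup (f : boundedOp) :
  has_sup [set complex.Re `|f x| | x in [set x | `|x| <= 1]].
Proof.
split; first by exists (complex.Re `|f 0|), 0 => //=; rewrite normr0 ler01.
have /linear_boundedP/pinfty_ex_gt0[M M0 fM] :=
  (linear_bounded_continuous f).2 (@bop_continuous f).
exists (complex.Re M) => _ [x /= x1 <-].
rewrite -lecR normRe RRe_real ?gtr0_real// (le_trans (fM x))//.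
by rewrite ler_piMr// ltW.
Qed.

Lemma opnorm_ge0 (f : boundedOp) : 0 <= opnorm f.
Proof.
rewrite /opnorm ler0c; apply: (@le_trans _ _ (complex.Re `|f 0|)).
  by rewrite linear0 normr0.
apply: sup_upper_bound; first exact: opnorm_has_sup.
by exists 0 => //=; rewrite normr0 ler01.
Qed.

Lemma le_opnorm (f : boundedOp) x : `|f x| <= opnorm f * `|x|.
Proof.
have [->|x0] := eqVneq x 0; first by rewrite linear0 !normr0 mulr0.
have nx : 0 < `|x| by rewrite normr_gt0.
rewrite -ler_pdivrMr// mulrC.
have -> : `|x|^-1 * `|f x| = `|f (`|x|^-1 *: x)|.
  by rewrite linearZ/= normrZ normfV normr_id.
rewrite -normRe /opnorm lecR; apply: sup_upper_bound.
  exact: opnorm_has_sup.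
exists (`|x|^-1 *: x) => //=.
by rewrite normrZ normfV normr_id mulVf ?gt_eqF.
Qed.

Lemma opnorm_le (f : boundedOp) (c : R[i]) :
  (forall x, `|x| <= 1 -> `|f x| <= c) -> opnorm f <= c.
Proof.
move=> fc; have c0 : 0 <= c.
  by apply: le_trans (fc 0 _); rewrite ?normr0 ?ler01.
rewrite -[c]RRe_real ?ger0_real// /opnorm lecR.
apply: ge_sup; first by case: (opnorm_has_sup f).
move=> _ [x /= x1 <-]; rewrite -lecR normRe RRe_real ?ger0_real//.
exact: fc.
Qed.

Fact opnormD (f g : boundedOp) : opnorm (f + g) <= opnorm f + opnorm g.
Proof.
apply: opnorm_le => x x1; rewrite add_bopE (le_trans (ler_normD _ _))//.
by apply: lerD; apply: (le_trans (le_opnorm _ _));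
  rewrite ler_piMr// opnorm_ge0.
Qed.

Let opnormZ_le a (f : boundedOp) : opnorm (a *: f) <= `|a| * opnorm f.
Proof.
apply: opnorm_le => x x1; rewrite scale_bopE normrZ ler_wpM2l//.
by rewrite (le_trans (le_opnorm _ _))// ler_piMr// opnorm_ge0.
Qed.

Fact opnormZ a (f : boundedOp) : opnorm (a *: f) = `|a| * opnorm f.
Proof.
apply/eqP; rewrite eq_le opnormZ_le /=.
have [->|a0] := eqVneq a 0; first by rewrite normr0 mul0r opnorm_ge0.
rewrite -ler_pdivlMl ?normr_gt0// -normfV.
by rewrite (le_trans _ (opnormZ_le _ _))// scalerA mulVf// scale1r.
Qed.

Fact opnorm0_eq0 (f : boundedOp) : opnorm f = 0 -> f = 0.
Proof.
move=> f0; apply/boundedOpP => x; apply/normr0_eq0/eqP.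
by rewrite eq_le normr_ge0 andbT (le_trans (le_opnorm _ _))// f0 mul0r.
Qed.

HB.instance Definition _ :=
  Lmodule_isNormed.Build R[i] boundedOp opnormD opnormZ opnorm0_eq0.

End BoundedOp.

Section BoundedOpRing.
Context {R : realType}.

Fact bop_comp_subproof (U V W : normedModType R[i])
    (f : boundedOp V W) (g : boundedOp U V) : f \o g \in @is_bounded_op R U W.
Proof.
apply/bounded_opP; split; first by move=> a x y /=; rewrite !linearP.
by move=> x; apply: continuous_comp; exact: bop_continuous.
Qed.
Definition bop_comp (U V W : normedModType R[i])
  (f : boundedOp V W) (g : boundedOp U V) : boundedOp U W :=
  BoundedOp (bop_comp_subproof f g).

Variable X : normedModType R[i].

Fact bop_id_subproof : @idfun X \in @is_bounded_op R X X.
Proof. by apply/bounded_opP; split => // x; exact: cvg_id. Qed.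
Definition bop_id : boundedOp X X := BoundedOp bop_id_subproof.

Fact bop_compA : associative (@bop_comp X X X).
Proof. by move=> f g h; apply: boundedOpP. Qed.
Fact bop_comp1l : left_id bop_id (@bop_comp X X X).
Proof. by move=> f; apply: boundedOpP. Qed.
Fact bop_comp1r : right_id bop_id (@bop_comp X X X).
Proof. by move=> f; apply: boundedOpP. Qed.
Fact bop_compDl : left_distributive (@bop_comp X X X) +%R.
Proof. by move=> f g h; apply: boundedOpP. Qed.
Fact bop_compDr : right_distributive (@bop_comp X X X) +%R.
Proof. by move=> f g h; apply: boundedOpP => x /=; rewrite linearD. Qed.

(* Only a possibly trivial ring: [X] may be the zero space. *)
HB.instance Definition _ := GRing.Zmodule_isPzRing.Build (boundedOp X X)
  bop_compA bop_comp1l bop_comp1r bop_compDl bop_compDr.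

Lemma mul_bopE (f g : boundedOp X X) x : (f * g) x = f (g x). Proof. by []. Qed.
Lemma one_bopE x : (1 : boundedOp X X) x = x. Proof. by []. Qed.

Definition sub_scalar (T : boundedOp X X) (l : Cplx R) : boundedOp X X :=
  T - (l : R[i]) *: (1 : boundedOp X X).

Lemma sub_scalarE T l x : sub_scalar T l x = T x - (l : R[i]) *: x.
Proof. by []. Qed.

End BoundedOpRing.

Section Dual.
Context {R : realType} (X : normedModType R[i]).

Local Notation dual := (boundedOp X (Cplx R)).

Variable T : boundedOp X X.

Definition dual_op_fun (phi : dual) : dual := bop_comp phi T.

Fact dual_op_linear : linear dual_op_fun.
Proof. by move=> a f g; apply: val_inj; apply: funext. Qed.
HB.instance Definition _ :=
  GRing.isLinear.Build R[i] dual dual *:%R dual_op_fun dual_op_linear.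

Fact dual_op_subproof : dual_op_fun \in @is_bounded_op R dual dual.
Proof.
apply/bounded_opP; split; first exact: dual_op_linear.
apply: (@bounded_linear_continuous _ _ _ dual_op_fun); apply/linear_boundedP.
exists (opnorm T); split; first by rewrite ger0_real// opnorm_ge0.
move=> r Tr phi; apply: opnorm_le => x x1 /=.
rewrite (le_trans (le_opnorm _ _))// mulrC ler_wpM2r ?opnorm_ge0//.
rewrite (le_trans (le_opnorm _ _))// (le_trans _ (ltW Tr))//.
by rewrite ler_piMr// opnorm_ge0.
Qed.
Definition dual_op : boundedOp dual dual := BoundedOp dual_op_subproof.

End Dual.

Section Submodule.
Context {R : realType} (X : normedModType R[i]).

Section SubmodNormed.
Variable M : submodClosed X.

Record subspaceOf := SubspaceOf {
  sub_val :> X;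
  sub_valP : sub_val \in M }.

HB.instance Definition _ := [isSub for sub_val].
HB.instance Definition _ := [Choice of subspaceOf by <:].
HB.instance Definition _ := [SubChoice_isSubLmodule of subspaceOf by <:].

Let subnorm (x : subspaceOf) : R[i] := `|sub_val x|.
Fact subnormD x y : subnorm (x + y) <= subnorm x + subnorm y.
Proof. exact: ler_normD. Qed.
Fact subnormZ a x : subnorm (a *: x) = `|a| * subnorm x.
Proof. exact: normrZ. Qed.
Fact subnorm0_eq0 x : subnorm x = 0 -> x = 0.
Proof. by move=> /normr0_eq0 x0; apply: val_inj. Qed.
HB.instance Definition _ :=
  Lmodule_isNormed.Build R[i] subspaceOf subnormD subnormZ subnorm0_eq0.

Lemma sub_normE (x : subspaceOf) : `|x| = `|sub_val x|. Proof. by []. Qed.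

End SubmodNormed.

Definition op_invariant (T : boundedOp X X) (M : {pred X}) :=
  {homo T : x / x \in M}.

Section Restriction.
Variables (T : boundedOp X X) (M : submodClosed X) (TM : op_invariant T M).

Definition restr_fun (x : subspaceOf M) : subspaceOf M :=
  SubspaceOf (TM (sub_valP x)).

Fact restr_subproof : restr_fun \in @is_bounded_op R (subspaceOf M) (subspaceOf M).
Proof.
apply/bounded_opP.
have lin : linear restr_fun.
  by move=> a x y; apply: val_inj; rewrite /= linearP.
split=> //.
pose F : {linear _ -> _} := HB.pack restr_fun
  (GRing.isLinear.Build _ _ _ _ _ lin).
apply: (@bounded_linear_continuous _ _ _ F); apply/linear_boundedP.
exists (opnorm T); split; first by rewrite ger0_real// opnorm_ge0.
move=> r Tr x; rewrite !sub_normE /= (le_trans (le_opnorm _ _))//.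
by rewrite ler_wpM2r// ltW.
Qed.
Definition restr : boundedOp (subspaceOf M) (subspaceOf M) :=
  BoundedOp restr_subproof.

End Restriction.

Section Range.
Variable T : boundedOp X X.

Definition range_pred : {pred X} := fun y => `[< range T y >].

Fact range_submod_closed : submod_closed range_pred.
Proof.
split; first by apply/asboolP; exists 0; rewrite ?linear0.
move=> a _ _ /asboolP[x _ <-] /asboolP[y _ <-].
by apply/asboolP; exists (a *: x + y); rewrite ?linearP.
Qed.
HB.instance Definition _ :=
  GRing.isSubmodClosed.Build R[i] X range_pred range_submod_closed.

End Range.

Lemma range_exp_invariant (T : boundedOp X X) n :
  op_invariant T (range_pred (T ^+ n)).
Proof.
move=> _ /asboolP[x _ <-]; apply/asboolP; exists (T x) => //.
by rewrite -!mul_bopE -exprSr -exprS.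
Qed.

End Submodule.

(* No definition below mentions completeness, so they are all stated for normed
   spaces; they are meant for a Banach space, its dual and its closed
   subspaces, which are all complete. *)

Section Dimension.
Context {R : realType} (V : lmodType R[i]).

Definition finite_dim (A : set V) :=
  exists n (e : 'I_n -> V), forall x, A x ->
    exists c : 'I_n -> R[i], x = \sum_i c i *: e i.

Definition finite_codim (A : set V) :=
  exists n (e : 'I_n -> V), forall x,
    exists c : 'I_n -> R[i], A (x - \sum_i c i *: e i).

End Dimension.

Section Analytic.
Context {R : realType} (Y : normedModType R[i]).

Definition analytic_at (f : Cplx R -> Y) (z0 : Cplx R) :=
  exists a : nat -> Y, \forall z \near z0,
    series (fun n => (z - z0) ^+ n *: a n) @ \oo --> f z.

Definition is_pole (f : Cplx R -> Y) (z0 : Cplx R) :=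
  exists (k : nat) (g : Cplx R -> Y), [/\ (0 < k)%N, analytic_at g z0, g z0 != 0
    & \forall z \near z0^', f z = (z - z0) ^- k *: g z].

End Analytic.

Section Spectral.
Context {R : realType} (Y : normedModType R[i]).
Implicit Type S : boundedOp Y Y.

Definition is_inverse S (U : boundedOp Y Y) := S * U = 1 /\ U * S = 1.

Definition spectrum S : set (Cplx R) :=
  [set l | ~ exists U, is_inverse (sub_scalar S l) U].

(* Takes the junk value 0 on the spectrum. *)
Definition resolvent S (l : Cplx R) : boundedOp Y Y :=
  xget 0 [set U | is_inverse (sub_scalar S l) U].

Definition resolvent_pole S (l : Cplx R) :=
  isolated (spectrum S) l /\ is_pole (resolvent S) l.

Definition meromorphic S :=
  forall l, spectrum S l -> l != 0 -> resolvent_pole S l.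

Definition SVEP_at S (l0 : Cplx R) :=
  forall r : R[i], 0 < r -> forall f : Cplx R -> Y,
    (forall l, ball l0 r l -> analytic_at f l) ->
    (forall l, ball l0 r l -> (sub_scalar S l) (f l) = 0) ->
    forall l, ball l0 r l -> f l = 0.

Definition SVEP S := forall l0, SVEP_at S l0.

End Spectral.

Section Classes.
Context {R : realType} (Y : normedModType R[i]).
Implicit Type S : boundedOp Y Y.

Definition op_kernel S : set Y := [set x | S x = 0].

Definition Kato S :=
  closed (range S) /\ forall n, op_kernel S `<=` range (S ^+ n).

Definition finite_ascent S := exists n, op_kernel (S ^+ n) = op_kernel (S ^+ n.+1).
Definition finite_descent S := exists n, range (S ^+ n) = range (S ^+ n.+1).

Definition upper_semi_Fredholm S := finite_dim (op_kernel S) /\ closed (range S).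
Definition lower_semi_Fredholm S := finite_codim (range S).

Definition upper_semi_Browder S := upper_semi_Fredholm S /\ finite_ascent S.
Definition lower_semi_Browder S := lower_semi_Fredholm S /\ finite_descent S.
Definition Browder S := upper_semi_Browder S /\ lower_semi_Browder S.

End Classes.

Section BClasses.
Context {R : realType} (X : normedModType R[i]).
Implicit Type T : boundedOp X X.

Definition restr_range T n := restr (@range_exp_invariant R X T n).

Definition upper_semi_B_Browder T :=
  exists n, closed (range (T ^+ n)) /\ upper_semi_Browder (restr_range T n).
Definition lower_semi_B_Browder T :=
  exists n, closed (range (T ^+ n)) /\ lower_semi_Browder (restr_range T n).
Definition B_Browder T :=
  exists n, closed (range (T ^+ n)) /\ Browder (restr_range T n).

Record Red T (M N : submodClosed X) : Prop := {
  red_closedl : closed [set` M];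
  red_closedr : closed [set` N];
  red_invl : op_invariant T M;
  red_invr : op_invariant T N;
  red_sum : forall x, exists y z, [/\ y \in M, z \in N & x = y + z];
  red_cap : forall x, x \in M -> x \in N -> x = 0 }.

Definition gen_Kato_meromorphic T :=
  exists (M N : submodClosed X) (MN : Red T M N),
    Kato (restr (red_invl MN)) /\ meromorphic (restr (red_invr MN)).

Definition sigma_gKM T : set (Cplx R) :=
  [set l | ~ gen_Kato_meromorphic (sub_scalar T l)].
Definition sigma_BBp T : set (Cplx R) :=
  [set l | ~ upper_semi_B_Browder (sub_scalar T l)].
Definition sigma_BBm T : set (Cplx R) :=
  [set l | ~ lower_semi_B_Browder (sub_scalar T l)].
Definition sigma_BB T : set (Cplx R) :=
  [set l | ~ B_Browder (sub_scalar T l)].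

End BClasses.

(* Main.v *)
(* Let T - p, rewritten T after translation, admit a decomposition X = M + N with
   T_M Kato and T_N meromorphic.  For small mu <> 0 the operator T_N - mu is
   Drazin invertible: either mu is in the resolvent set, or comparing Laurent
   coefficients of the resolvent at the pole mu produces a Drazin inverse.
   On M, a kernel vector x_0 of T_M lifts to a geometrically bounded backward
   orbit T x_{n+1} = x_n, since N(T_M) is contained in every R(T_M^n) and the open
   mapping theorem applies to T_M; the sum of mu^n x_n is then an analytic kernel
   function of T - mu, so the SVEP forces T_M to be injective, hence bounded below.
   Dually, a functional killing R(T_M) lifts through T_M by the open mapping and
   Hahn-Banach theorems, so the SVEP of T' forces T_M to be onto.  Both properties
   survive a small perturbation, and the direct sum T - mu, restricted to
   R((T - mu)^k) with k the Drazin index of T_N - mu, is injective with closed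
   range, respectively onto. *)
Require Import Defs.
From HB Require Import structures.
From mathcomp Require Import all_boot all_order all_algebra.
From mathcomp Require Import all_classical all_reals all_analysis.
From mathcomp Require Import complex.
From mathcomp Require Import lra ring.

Set Implicit Arguments.
Unset Strict Implicit.
Unset Printing Implicit Defensive.

Import Order.TTheory GRing.Theory Num.Theory.
Import numFieldNormedType.Exports.

Local Open Scope classical_set_scope.
Local Open Scope ring_scope.

(** * The real-valued norm *)

Section RealNorm.
Context {R : realType}.
Implicit Types U V W : normedModType R[i].

(* Norms over [R[i]] have values in [R[i]], whose order is partial; [nr] is the
   same norm with values in [R]. *)
Definition nr {V} (x : V) : R := complex.Re `|x|.

Lemma nrE V (x : V) : `|x| = (nr x)%:C%C.
Proof. by rewrite /nr RRe_real ?normr_real. Qed.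

Lemma nr_ge0 V (x : V) : 0 <= nr x.
Proof. by rewrite -lecR -nrE; exact: normr_ge0. Qed.

Lemma ler_nrD V (x y : V) : nr (x + y) <= nr x + nr y.
Proof. by rewrite -lecR rmorphD /= -!nrE; exact: ler_normD. Qed.

Lemma nrN V (x : V) : nr (- x) = nr x.
Proof. by rewrite /nr normrN. Qed.

Lemma nr_distC V (x y : V) : nr (x - y) = nr (y - x).
Proof. by rewrite -nrN opprB. Qed.

Lemma ler_nrB V (x y : V) : nr (x - y) <= nr x + nr y.
Proof. by rewrite (le_trans (ler_nrD _ _))// nrN. Qed.

Lemma ler_nr_distD V (z x y : V) : nr (x - y) <= nr (x - z) + nr (z - y).
Proof. by rewrite (le_trans _ (ler_nrD _ _))// subrKA. Qed.

Lemma nr0 V : nr (0 : V) = 0.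
Proof. by rewrite /nr normr0. Qed.

Lemma nr0_eq0 V (x : V) : nr x = 0 -> x = 0.
Proof. by move=> x0; apply: normr0_eq0; rewrite nrE x0. Qed.

Lemma nr_gt0 V (x : V) : x != 0 -> 0 < nr x.
Proof.
move=> x0; rewrite lt_neqAle nr_ge0 andbT eq_sym.
by apply: contra x0 => /eqP/nr0_eq0 ->.
Qed.

Lemma nrZ V (a : R[i]) (x : V) : nr (a *: x) = nr (a : Cplx R) * nr x.
Proof.
apply: complexI; rewrite rmorphM /= -!nrE.
exact: normrZ.
Qed.

Lemma nr_real (r : R) : nr (r%:C%C : Cplx R) = `|r|.
Proof.
by rewrite /nr normc_def /= expr0n /= addr0 sqrtr_sqr.
Qed.

Lemma nrX (a : Cplx R) n : nr (a ^+ n) = nr a ^+ n.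
Proof.
by apply: complexI; rewrite rmorphXn /= -!nrE normrX.
Qed.

Lemma ler_nr_sum V (I : Type) (s : seq I) (P : pred I) (F : I -> V) :
  nr (\sum_(i <- s | P i) F i) <= \sum_(i <- s | P i) nr (F i).
Proof.
elim/big_rec2: _ => [|i x y _ xy]; first by rewrite nr0.
by rewrite (le_trans (ler_nrD _ _))// lerD2l.
Qed.

Lemma cvg_nrP V (u : nat -> V) (l : V) :
  u @ \oo --> l <->
  forall e : R, 0 < e -> exists N, forall n, (N <= n)%N -> nr (u n - l) < e.
Proof.
split.
  move=> /cvgrPdist_lt ul e e0.
  have /ul : 0 < e%:C%C by rewrite ltcR.
  case=> N _ uN; exists N => n Nn.
  by rewrite -ltcR -nrE distrC; exact: uN.
move=> ul; apply/cvgrPdist_lt => e e0.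
have eE : e = (complex.Re e)%:C%C by rewrite RRe_real// gtr0_real.
have /ul[N uN] : 0 < complex.Re e by rewrite -ltcR -eE.
exists N => //= n Nn; rewrite distrC nrE eE ltcR; exact: uN.
Qed.

Lemma nr_nearP V (z0 : V) (P : V -> Prop) :
  (\forall z \near z0, P z) <->
  exists2 r : R, 0 < r & forall z, nr (z - z0) < r -> P z.
Proof.
split.
  move=> /nbhs_normP[e /= e0 eP].
  have eE : e = (complex.Re e)%:C%C by rewrite RRe_real// gtr0_real.
  exists (complex.Re e); first by rewrite -ltcR -eE.
  by move=> z zr; apply: eP => /=; rewrite distrC nrE eE ltcR.
move=> [r r0 rP]; apply/nbhs_normP; exists r%:C%C => /=; first by rewrite ltcR.
by move=> z /=; rewrite distrC nrE ltcR; exact: rP.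
Qed.

Lemma nr_ball (z0 z : Cplx R) (r : R) : ball z0 r%:C%C z <-> nr (z - z0) < r.
Proof. by rewrite -ball_normE /= distrC nrE ltcR. Qed.

Lemma bounded_op_nr U V (T : boundedOp U V) :
  exists2 C : R, 0 < C & forall x, nr (T x) <= C * nr x.
Proof.
have /linear_boundedP/pinfty_ex_gt0[M M0 fM] :=
  (linear_bounded_continuous T).2 (@bop_continuous _ _ _ T).
have ME : M = (complex.Re M)%:C%C by rewrite RRe_real// gtr0_real.
exists (complex.Re M); first by rewrite -ltcR -ME.
by move=> x; rewrite -lecR rmorphM /= -!nrE -ME; exact: fM.
Qed.

Lemma linear_bounded_op U V (f : U -> V) (C : R) :
  linear f -> (forall x, nr (f x) <= C * nr x) ->
  exists T : boundedOp U V, forall x, T x = f x.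
Proof.
move=> lf fC.
suff h : f \in @is_bounded_op R U V by exists (BoundedOp h).
apply/bounded_opP; split=> //.
pose F : {linear U -> V} := HB.pack f (GRing.isLinear.Build _ _ _ _ _ lf).
apply: (@bounded_linear_continuous _ _ _ F); apply/linear_boundedP.
have C1 : 0 < Num.max C 1 by rewrite lt_max ltr01 orbT.
exists (Num.max C 1)%:C%C; split; first by rewrite ger0_real// ler0c ltW.
move=> r Cr x; rewrite (@le_trans _ _ ((Num.max C 1)%:C%C * `|x|))//; last first.
  by rewrite ler_wpM2r// ltW.
rewrite !nrE -rmorphM lecR (le_trans (fC x))//.
by rewrite ler_wpM2r ?nr_ge0// le_max lexx.
Qed.

Lemma cvg_bop U V (T : boundedOp U V) (u : nat -> U) l :
  u @ \oo --> l -> T (u n) @[n --> \oo] --> T l.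
Proof. by move=> ul; exact: (cvg_comp _ _ ul (@bop_continuous _ _ _ T l)). Qed.

Lemma cvgn_unique V (u : nat -> V) (l k : V) :
  u @ \oo --> l -> u @ \oo --> k -> l = k.
Proof. by move=> ul uk; apply: (cvg_unique _ ul uk). Qed.

Lemma cvg_nr_le V (u : nat -> V) l (C : R) :
  u @ \oo --> l -> (forall n, nr (u n) <= C) -> nr l <= C.
Proof.
move=> /cvg_nrP ul uC; apply/ler_addgt0Pr => e /ul[N /(_ N (leqnn _)) uN].
have := ler_nr_distD (u N) l 0; rewrite !subr0 nr_distC => /le_trans -> //.
by rewrite addrC lerD// ltW.
Qed.

Lemma geometric_small (K q : R) : 0 <= q -> q < 1 -> forall e, 0 < e ->
  exists N, forall n, (N <= n)%N -> K * q ^+ n < e.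
Proof.
move=> q0 q1 e e0.
have /cvgrPdist_lt/(_ _ e0) : geometric K q @ \oo --> 0.
  by apply: cvg_geometric; rewrite ger0_norm.
move=> [N _ h]; exists N => n Nn; have := h n Nn.
by rewrite /= sub0r normrN; exact/le_lt_trans/ler_norm.
Qed.

(** Completeness is a predicate on sequences so that it can be proved for closed subspaces, products
    and operator spaces, which appear here as plain normed modules. *)
Definition seq_complete V := forall u : nat -> V,
  (forall e : R, 0 < e -> exists N, forall n m, (N <= n)%N -> (N <= m)%N ->
     nr (u n - u m) < e) -> exists l : V, u @ \oo --> l.

Lemma geometric_series_cvg V (cV : seq_complete V) (u : nat -> V) (K q : R) :
  0 <= q -> q < 1 -> (forall n, nr (u n) <= K * q ^+ n) ->
  exists2 l : V, series u @ \oo --> l & nr l <= K / (1 - q).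
Proof.
move=> q0 q1 uK.
have q1' : 0 < 1 - q by rewrite subr_gt0.
have K0 : 0 <= K by have := uK 0%N; rewrite expr0 mulr1; exact/le_trans/nr_ge0.
(* This bound on blocks of the series gives the Cauchy property, and at [n = 0] the bound on the
   sum. *)
have tail n m : (n <= m)%N ->
    nr (series u m - series u n) <= K / (1 - q) * q ^+ n.
  move=> nm; rewrite sub_series nm (le_trans (ler_nr_sum _ _ _))//.
  rewrite (@le_trans _ _ (\sum_(n <= k < m) K * q ^+ k))//.
    by apply: ler_sum => k _; exact: uK.
  have -> : K / (1 - q) * q ^+ n = K * (q ^+ n / (1 - q)) by rewrite mulrAC mulrA.
  rewrite -mulr_sumr ler_wpM2l// ler_pdivlMr//.
  elim: m nm => [|m IH].
    by rewrite leqn0 => /eqP ->; rewrite big_geq// mul0r exprn_ge0.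
  rewrite leq_eqVlt => /predU1P[->|]; first by rewrite big_geq// mul0r exprn_ge0.
  rewrite ltnS => nm.
  have -> : \sum_(n <= k < m.+1) q ^+ k = (q ^+ n - q ^+ m.+1) / (1 - q).
    elim: m nm {IH} => [|m IH].
      rewrite leqn0 => /eqP ->.
      by rewrite big_nat1 !exprS expr0 mulr1 divff ?gt_eqF.
    rewrite leq_eqVlt => /predU1P[->|]; last first.
      rewrite ltnS => nm; rewrite big_nat_recr /= ?IH//; last by rewrite ltnW.
      by rewrite !exprS; field; rewrite gt_eqF.
    by rewrite big_nat1 [X in _ - X]exprS; field; rewrite gt_eqF.
  by rewrite divfK ?gt_eqF// gerBl exprn_ge0.
have [l ul] : exists l : V, series u @ \oo --> l.
  apply: cV => e e0.
  have [N hN] := geometric_small (K / (1 - q)) q0 q1 e0.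
  have h n m : (N <= n)%N -> (n <= m)%N -> nr (series u n - series u m) < e.
    by move=> Nn nm; rewrite nr_distC (le_lt_trans (tail _ _ nm))// hN.
  exists N => n m Nn Nm; have [nm|/ltnW mn] := leqP n m; first exact: h.
  by rewrite nr_distC; exact: h.
exists l => //; apply: (cvg_nr_le ul) => n.
have := tail 0%N n (leq0n n).
by rewrite /series /= [X in _ - X]big_geq// subr0 expr0 mulr1.
Qed.

Lemma seq_complete_banach (X : completeNormedModType R[i]) : seq_complete X.
Proof.
move=> u uc; apply/cvg_ex/cauchy_cvgP/cauchy_exP => e e0.
have eE : e = (complex.Re e)%:C%C by rewrite RRe_real// gtr0_real.
have /uc[N hN] : 0 < complex.Re e by rewrite -ltcR -eE.
exists (u N), N => // n Nn.
by rewrite /= -ball_normE /= nrE eE ltcR; exact: hN.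
Qed.

Lemma closed_seqP V (E : set V) :
  closed E <->
  forall (u : nat -> V) (l : V), (forall n, E (u n)) -> u @ \oo --> l -> E l.
Proof.
split=> [cE u l Eu ul|h].
  by apply: (@closed_cvg _ _ _ _ u E cE _ l ul); exact: nearW.
move=> x Ex.
have /choice[u hu] : forall n, exists y, E y /\ nr (y - x) < 2^-1 ^+ n.
  move=> n; have [|y [Ey xy]] := Ex (ball x (2^-1 ^+ n)%:C%C).
    by apply: nbhsx_ballx; rewrite ltcR exprn_gt0.
  by exists y; split=> //; move: xy; rewrite -ball_normE /= distrC nrE ltcR.
apply: (h u) => [n|]; first by have [] := hu n.
apply/cvg_nrP => e e0.
have [||N hN] := @geometric_small 1 2^-1 _ _ e e0; [lra|lra|].
exists N => n /hN; rewrite mul1r; apply: lt_trans; by have [] := hu n.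
Qed.

End RealNorm.
Arguments cvg_bop {R U V} T {u l}.

(** * Completeness and the open mapping theorem *)

Section Completeness.
Context {R : realType}.
Implicit Types U V W : normedModType R[i].

Lemma nr_bop U V (T : boundedOp U V) x : nr (T x) <= nr T * nr x.
Proof.
by rewrite -lecR rmorphM /= -!nrE; exact: le_opnorm.
Qed.

Lemma nr_bop_le U V (T : boundedOp U V) (C : R) :
  0 <= C -> (forall x, nr (T x) <= C * nr x) -> nr T <= C.
Proof.
move=> C0 TC; rewrite -lecR -nrE; apply: opnorm_le => x x1.
rewrite nrE lecR (le_trans (TC x))// ler_piMr//.
by rewrite -lecR -nrE.
Qed.

Lemma seq_complete_sub V (M : submodClosed V) :
  seq_complete V -> closed [set` M] -> seq_complete (subspaceOf M).
Proof.
move=> cV /closed_seqP cM u uc.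
have [l ul] : exists l : V, (fun n => sub_val (u n)) @ \oo --> l by exact: cV.
have lM : l \in M by apply: cM ul => n; exact: sub_valP.
by exists (SubspaceOf lM); apply/cvg_nrP; move/cvg_nrP: ul.
Qed.

Lemma nr_pair U V (x : U * V) : nr x = Num.max (nr x.1) (nr x.2).
Proof.
apply: complexI; rewrite -nrE prod_normE !nrE.
have [xy|/ltW xy] := leP (nr x.1) (nr x.2).
  by rewrite max_r// lecR.
by rewrite max_l// lecR.
Qed.

Lemma seq_complete_prod U V :
  seq_complete U -> seq_complete V -> seq_complete (U * V)%type.
Proof.
move=> cU cV u uc.
have [l ul] : exists l : U, (fun n => (u n).1) @ \oo --> l.
  apply: cU => e /uc[N hN]; exists N => n m Nn Nm.
  by have := hN _ _ Nn Nm; rewrite nr_pair gt_max => /andP[].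
have [k uk] : exists l : V, (fun n => (u n).2) @ \oo --> l.
  apply: cV => e /uc[N hN]; exists N => n m Nn Nm.
  by have := hN _ _ Nn Nm; rewrite nr_pair gt_max => /andP[].
exists (l, k); apply/cvg_nrP => e e0.
move/cvg_nrP: ul => /(_ e e0)[N hN]; move/cvg_nrP: uk => /(_ e e0)[N' hN'].
exists (maxn N N') => n; rewrite geq_max => /andP[Nn N'n].
by rewrite nr_pair gt_max hN//= hN'.
Qed.

Lemma nr_ge_Re (z : Cplx R) : `|complex.Re z| <= nr z.
Proof. by rewrite -lecR -nrE; exact: normc_ge_Re. Qed.

Lemma nr_mulil (z : Cplx R) : nr ('i%C * z : Cplx R) = nr z.
Proof.
rewrite (nrZ 'i%C z); suff -> : nr ('i%C : Cplx R) = 1 by rewrite mul1r.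
by rewrite /nr normc_def /= expr0n /= add0r expr1n sqrtr1.
Qed.

Lemma nr_ge_Im (z : Cplx R) : `|complex.Im z| <= nr z.
Proof.
rewrite -nr_mulil; apply: le_trans (nr_ge_Re _).
by case: z => a b /=; rewrite !mul0r mul1r sub0r normrN.
Qed.

Lemma nr_le_ReIm (z : Cplx R) : nr z <= `|complex.Re z| + `|complex.Im z|.
Proof.
rewrite [X in nr X]complexE (le_trans (ler_nrD _ _))// nr_real lerD2l.
by rewrite nr_mulil nr_real.
Qed.

Lemma real_seq_complete (u : nat -> R) :
  (forall e : R, 0 < e -> exists N, forall n m, (N <= n)%N -> (N <= m)%N ->
     `|u n - u m| < e) -> exists l : R, forall e, 0 < e -> exists N, forall n,
     (N <= n)%N -> `|u n - l| < e.
Proof.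
move=> uc.
have /cvg_ex[l ul] : cvg (u @ \oo).
  apply/cauchy_cvgP/cauchy_exP => e /uc[N hN].
  by exists (u N), N => // n Nn; rewrite /= -ball_normE /=; exact: hN.
exists l => e e0; move/cvgrPdist_lt: ul => /(_ e e0)[N _ hN].
by exists N => n Nn; rewrite distrC; exact: hN.
Qed.

Lemma seq_complete_complex : seq_complete (Cplx R).
Proof.
move=> u uc.
have [e /uc[N hN]|a ua] := @real_seq_complete (fun n => complex.Re (u n)).
  exists N => n m Nn Nm; apply: le_lt_trans (hN _ _ Nn Nm).
  by rewrite -raddfB nr_ge_Re.
have [e /uc[N hN]|b ub] := @real_seq_complete (fun n => complex.Im (u n)).
  exists N => n m Nn Nm; apply: le_lt_trans (hN _ _ Nn Nm).
  by rewrite -raddfB nr_ge_Im.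
exists (a +i* b)%C; apply/cvg_nrP => e e0.
have [N hN] := ua (e / 2) (divr_gt0 e0 (ltr0Sn _ 1)).
have [N' hN'] := ub (e / 2) (divr_gt0 e0 (ltr0Sn _ 1)).
exists (maxn N N') => n; rewrite geq_max => /andP[/hN ha /hN' hb].
rewrite (le_lt_trans (nr_le_ReIm _))// !raddfB /=.
by lra.
Qed.

(** The pointwise limits form a bounded operator, and letting one index tend to infinity in the
    Cauchy estimate gives convergence in norm. In particular the dual space is complete, so power
    series of functionals can be summed there. *)
Lemma seq_complete_bop U V : seq_complete V -> seq_complete (boundedOp U V).
Proof.
move=> cV u uc.
have /choice[f uf] : forall x, exists l : V, (fun n => u n x) @ \oo --> l.
  move=> x; apply: cV => e e0.
  have x1 : 0 < nr x + 1 by rewrite ltr_wpDl// nr_ge0.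
  have /uc[N hN] : 0 < e / (nr x + 1) by rewrite divr_gt0.
  exists N => n m Nn Nm; apply: (@le_lt_trans _ _ (nr (u n - u m) * nr x)).
    exact: (nr_bop (u n - u m) x).
  have := hN _ _ Nn Nm; rewrite ltr_pdivlMr//; apply: le_lt_trans.
  by rewrite ler_wpM2l ?nr_ge0// lerDl.
have lf : linear f.
  move=> a x y; apply: (cvgn_unique (uf (a *: x + y))).
  rewrite (_ : (fun n => u n _) = (fun n => a *: u n x + u n y)); last first.
    by apply/funext => n; rewrite linearP.
  by apply: cvgD; [apply: cvgZr; exact: uf|exact: uf].
have tail (e : R) : 0 < e -> exists N, forall n, (N <= n)%N ->
    forall x, nr (u n x - f x) <= e * nr x.
  move=> /uc[N hN]; exists N => n Nn x; rewrite nr_distC.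
  have h : (fun m => u (m + N)%N x - u n x) @ \oo --> f x - u n x.
    apply: cvgB; last exact: cvg_cst.
    by rewrite (@cvg_shiftn N _ (fun n => u n x)).
  apply: (cvg_nr_le h) => m; apply: (le_trans (nr_bop (u (m + N)%N - u n) x)).
  by rewrite ler_wpM2r ?nr_ge0// ltW// hN// leq_addl.
have [N /(_ N (leqnn _)) hN] := tail 1 ltr01.
have [T Tf] : exists T : boundedOp U V, forall x, T x = f x.
  apply: (@linear_bounded_op _ _ _ _ (nr (u N) + 1)) => // x.
  have := ler_nr_distD (u N x) (f x) 0; rewrite !subr0 => /le_trans; apply.
  by rewrite addrC mulrDl lerD ?nr_bop// nr_distC; exact: hN.
exists T; apply/cvg_nrP => e e0.
have [N' hN'] := tail (e / 2) (divr_gt0 e0 (ltr0Sn _ 1)).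
exists N' => n N'n; apply: (@le_lt_trans _ _ (e / 2)); last by lra.
apply: nr_bop_le => [|x]; first by lra.
by rewrite add_bopE opp_bopE Tf hN'.
Qed.

End Completeness.

(** * Baire category and the open mapping theorem *)

Section OpenMapping.
Context {R : realType}.
Implicit Types U V : normedModType R[i].

(** Nested balls with centres in [W] shrink to the required point. Working relative to a closed set
    lets the open mapping theorem treat a closed range without making it a space of its own. *)
Lemma baire V (cV : seq_complete V) (W : set V) (F : nat -> set V) :
  closed W -> W !=set0 ->
  (forall n c (r : R), W c -> 0 < r -> exists c' (r' : R), [/\ W c', 0 < r' &
     forall z, nr (z - c') < r' -> nr (z - c) < r /\ ~ F n z]) ->
  exists2 w, W w & forall n, ~ F n w.
Proof.
move=> /closed_seqP clW [w0 Ww0] hF.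
pose T := {p : V * R | W p.1 /\ 0 < p.2}.
pose good n (p q : T) := (sval q).2 <= (sval p).2 / 2 /\
  forall z, nr (z - (sval q).1) <= (sval q).2 ->
    nr (z - (sval p).1) < (sval p).2 /\ ~ F n z.
have step (np : nat * T) : exists q, good np.1 np.2 q.
  case: np => n [[c r] [/= Wc r0]].
  have [c' [r' [Wc' r'0 h]]] := hF n c r Wc r0.
  (* [r / 2] makes the radii decay geometrically; [r' / 2] puts the new closed ball inside the open
     ball that avoids [F n]. *)
  have q0 : 0 < Num.min (r / 2) (r' / 2) by rewrite lt_min !divr_gt0.
  exists (exist _ (c', Num.min (r / 2) (r' / 2)) (conj Wc' q0)); split => /=.
    by rewrite ge_min lexx.
  move=> z zc'; apply: h; apply: le_lt_trans zc' _.
  by rewrite gt_min; apply/orP; right; lra.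
have [g hg] := choice step.
pose p := fix p n : T := if n is k.+1 then g (k, p k)
  else exist _ (w0, 1) (conj Ww0 ltr01).
have gp n : good n (p n) (p n.+1) by exact: (hg (n, p n)).
pose c n := (sval (p n)).1; pose r n := (sval (p n)).2.
have r0 n : 0 < r n by have [] := svalP (p n).
have rsmall n : r n <= 2^-1 ^+ n.
  elim: n => [|n IH]; first by rewrite expr0.
  rewrite exprSr (le_trans (proj1 (gp n)))//.
  by rewrite ler_wpM2r// invr_ge0.
have nest n k z : nr (z - c (n + k)%N) <= r (n + k)%N -> nr (z - c n) <= r n.
  elim: k => [|k IH]; first by rewrite addn0.
  by rewrite addnS => /(proj2 (gp _))[/ltW/IH].
have cc n k : nr (c (n + k)%N - c n) <= r n.
  by apply: (nest n k); rewrite subrr nr0 ltW.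
have [l cl] : exists l : V, c @ \oo --> l.
  apply: cV => e e0.
  have [||N hN] := @geometric_small R 2 2^-1 _ _ e e0; [lra|lra|].
  exists N => n m Nn Nm; apply: le_lt_trans (hN N (leqnn _)).
  apply: (le_trans (ler_nr_distD (c N) _ _)).
  rewrite mulrDl mul1r lerD//; last rewrite nr_distC.
    by rewrite -(subnKC Nn) (le_trans (cc _ _)).
  by rewrite -(subnKC Nm) (le_trans (cc _ _)).
exists l; first by apply: (clW c) => // n; have [] := svalP (p n).
move=> n; have [|_] := proj2 (gp n) l; last by [].
have h : (fun k => c (k + n.+1)%N - c n.+1) @ \oo --> l - c n.+1.
  by apply: cvgB; [rewrite (@cvg_shiftn n.+1 _ c)|exact: cvg_cst].
by apply: (cvg_nr_le h) => k; rewrite addnC cc.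
Qed.

(** By Baire, the image of some ball is dense in a relative ball of the range. Translation and
    scaling centre that ball at 0, and successive corrections, each halving the remainder, add up to
    an exact preimage. *)
Lemma open_mapping U V (cU : seq_complete U) (cV : seq_complete V)
    (T : boundedOp U V) : closed (range T) ->
  exists2 C : R, 0 < C &
    forall y, range T y -> exists2 x, T x = y & nr x <= C * nr y.
Proof.
move=> clT; have [K K0 TK] := bounded_op_nr T.
have range0 : range T 0 by exists 0; rewrite ?linear0.
have rangeD x y : range T x -> range T y -> range T (x + y).
  by move=> [a _ <-] [b _ <-]; exists (a + b); rewrite ?linearD.
have rangeZ a x : range T x -> range T (a *: x).
  by move=> [b _ <-]; exists (a *: b); rewrite ?linearZ.
(* This is the closure of the image of the closed ball of radius [n]. *)
pose F n : set V := fun y => forall e, 0 < e ->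
  exists2 x, nr x <= n%:R & nr (y - T x) < e.
have [n [c [r [Wc r0 h]]]] : exists n c (r : R), [/\ range T c, 0 < r &
    forall y, range T y -> nr (y - c) < r -> F n y].
  apply: contrapT => nF.
  (* If no [F n] contained a relative ball, some [T x] would lie outside every [F n], yet it belongs
     to [F n] once [n] exceeds the norm of [x]. *)
  have [|n c r Wc r0|w [x _ <-] /(_ (Num.bound (nr x)))] :=
    @baire V cV (range T) F clT.
  - by exists 0.
  - apply: contrapT => hc; apply: nF; exists n, c, r; split=> // y Wy yc.
    apply: contrapT => nFy; apply: hc.
    have [e e0 ye] : exists2 e : R, 0 < e & forall x, nr x <= n%:R -> e <= nr (y - T x).
      apply: contrapT => he; apply: nFy => e e0; apply: contrapT => hx; apply: he.
      exists e => // x xn; rewrite leNgt; apply/negP => xe; apply: hx.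
      by exists x.
    exists y, (Num.min (e / 2) (r - nr (y - c))); split=> //.
      by rewrite lt_min subr_gt0 yc andbT divr_gt0.
    move=> z; rewrite lt_min => /andP[ze zr]; split.
      by have := ler_nr_distD y z c; lra.
    move=> /(_ (e / 2) (divr_gt0 e0 (ltr0Sn _ 1)))[x xn zx].
    have := ler_nr_distD z y (T x); have := ye x xn.
    by rewrite (nr_distC y z); lra.
  - apply => e e0; exists x; last by rewrite subrr nr0.
    by apply: ltW; exact: archi_boundP (nr_ge0 x).
(* Subtracting approximate preimages of [y + c] and of [c] moves the ball to the origin and doubles
   the bound on preimages. *)
have near0 y (e : R) : range T y -> nr y < r -> 0 < e ->
    exists2 x, nr x <= (n + n)%:R & nr (y - T x) < e.
  move=> Wy yr e0.
  have [||x xn xe] := h (y + c) _ _ (e / 2) (divr_gt0 e0 (ltr0Sn _ 1)).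
  - exact: rangeD.
  - by rewrite addrK.
  have [||x' xn' xe'] := h c _ _ (e / 2) (divr_gt0 e0 (ltr0Sn _ 1)) => //.
    by rewrite subrr nr0.
  exists (x - x'); first by rewrite natrD (le_trans (ler_nrB _ _))// lerD.
  have -> : y - T (x - x') = (y + c - T x) - (c - T x').
    rewrite -[y + c - _]addrA -addrA opprB [_ + (T x' - c)]addrC subrKA.
    by rewrite linearB opprB.
  by have := ler_nrB (y + c - T x) (c - T x'); lra.
pose C := (n + n)%:R * (2 / r) : R.
have C0 : 0 <= C by rewrite mulr_ge0// divr_ge0// ltW.
(* Scaling [y] to norm [r / 2] explains the factor [2 / r] in [C]; the tolerance [r / 4] is then
   half of the norm. *)
have half y : range T y -> exists2 x, nr x <= C * nr y & nr (y - T x) <= nr y / 2.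
  move=> Wy; have [->|y0] := eqVneq y 0.
    by exists 0; rewrite ?linear0 ?addr0 !nr0 ?mulr0 ?mul0r.
  have ny := nr_gt0 y0; pose s := r / 2 / nr y.
  have s0 : 0 < s by rewrite !divr_gt0.
  have ns (Z : normedModType R[i]) (z : Z) : nr (s%:C%C *: z) = s * nr z.
    by rewrite nrZ nr_real gtr0_norm.
  have sV : s%:C%C != 0 :> R[i].
    by rewrite -(rmorph0 (real_complex R)) (inj_eq (@complexI _)) gt_eqF.
  have sy : s * nr y = r / 2 by rewrite /s divfK// gt_eqF.
  have [|||x xn xe] := near0 (s%:C%C *: y) (r / 4).
  - exact: rangeZ.
  - by rewrite ns sy; lra.
  - by lra.
  exists (s%:C%C^-1 *: x).
    rewrite -(ler_pM2l s0) -ns scalerA divff// scale1r mulrCA sy /C.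
    by rewrite -mulrA (_ : 2 / r * (r / 2) = 1) ?mulr1//; field; rewrite gt_eqF.
  rewrite -(ler_pM2l s0) -ns scalerBr [T (_ *: x)]linearZ /= scalerA divff// scale1r.
  by rewrite mulrA sy; lra.
have /choice[g hg] : forall y, exists x, range T y ->
    nr x <= C * nr y /\ nr (y - T x) <= nr y / 2.
  move=> y; have [Wy|nWy] := pselect (range T y); last by exists 0.
  by have [x ? ?] := half y Wy; exists x.
(* The geometric series of corrections gives the quotient; the added 1 makes the constant
   positive. *)
exists (C / (1 - 2^-1) + 1) => [|y Wy].
  by rewrite ltr_wpDl// divr_ge0//; lra.
(* [z k] is the remainder of [y] after [k] corrections. *)
pose z := fix z k := if k is j.+1 then z j - T (g (z j)) else y.
have Wz k : range T (z k).
  elim: k => //= k IH; rewrite -scaleN1r; apply: rangeD => //; apply: rangeZ.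
  by exists (g (z k)).
have zs k : nr (z k) <= nr y * 2^-1 ^+ k.
  elim: k => [|k IH]; first by rewrite expr0 mulr1.
  rewrite exprSr mulrA (le_trans (proj2 (hg _ (Wz k))))//.
  by rewrite ler_wpM2r// invr_ge0.
have [||k|x xs xle] :=
  @geometric_series_cvg R U cU (fun k => g (z k)) (C * nr y) 2^-1.
- by lra.
- by lra.
- by rewrite -mulrA (le_trans (proj1 (hg _ (Wz k))))// ler_wpM2l.
exists x; last first.
  by rewrite (le_trans xle)// mulrDl mul1r mulrAC lerDl nr_ge0.
apply: (cvgn_unique (cvg_bop T xs)).
apply/cvg_nrP => e e0.
have [||N hN] := @geometric_small R (nr y) 2^-1 _ _ e e0; [lra|lra|].
exists N => k /hN; apply: le_lt_trans; rewrite nr_distC.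
suff -> : y - T (series (fun k => g (z k)) k) = z k by exact: zs.
elim: k => [|k IH]; first by rewrite /series /= big_geq// linear0 subr0.
by rewrite seriesSr linearD opprD addrA IH.
Qed.

End OpenMapping.

(** * Power series and the SVEP *)

Section PowerSeries.
Context {R : realType} (Y : normedModType R[i]) (cY : seq_complete Y).
Implicit Types (x y : nat -> Y) (z : Cplx R).

(** [limn] is meaningful only for a convergent series, hence the geometric bounds carried along
    below. *)
Definition psum x z : Y := limn (series (fun n => (z ^+ n : R[i]) *: x n)).

Definition geo_bound (K rho : R) x := forall n, nr (x n) <= K * rho ^+ n.

Lemma geo_bound_ge0 K rho x : geo_bound K rho x -> 0 <= K.
Proof. by move=> /(_ 0%N); rewrite expr0 mulr1; exact/le_trans/nr_ge0. Qed.

Lemma psum_cvg K rho x z : 0 <= rho -> geo_bound K rho x -> nr z * rho < 1 ->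
  series (fun n => (z ^+ n : R[i]) *: x n) @ \oo --> psum x z /\
  nr (psum x z) <= K / (1 - nr z * rho).
Proof.
move=> rho0 xK zrho.
have [||n|l ul lK] := @geometric_series_cvg R Y cY
   (fun n => (z ^+ n : R[i]) *: x n) K (nr z * rho).
- by rewrite mulr_ge0// nr_ge0.
- by [].
- by rewrite nrZ nrX exprMn mulrCA ler_wpM2l// exprn_ge0// nr_ge0.
by have -> : psum x z = l by exact: cvg_lim ul.
Qed.

Lemma psum_recl K rho x z : 0 <= rho -> geo_bound K rho x -> nr z * rho < 1 ->
  psum x z = x 0%N + (z : R[i]) *: psum (x \o S) z.
Proof.
move=> rho0 xK zrho.
have [xs _] := psum_cvg rho0 xK zrho.
have xK' : geo_bound (K * rho) rho (x \o S).
  by move=> n; rewrite -mulrA -exprS; exact: xK.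
have [ys _] := psum_cvg rho0 xK' zrho.
apply: (@cvgn_unique _ _ (fun n => series (fun n => (z ^+ n : R[i]) *: x n) n.+1)).
  by rewrite (cvg_shiftS (series _)).
rewrite (_ : (fun n => _) = (fun n => x 0%N + (z : R[i]) *:
    series (fun n => (z ^+ n : R[i]) *: (x \o S) n) n)); last first.
  apply/funext => n; rewrite /series /= big_nat_recl// expr0 scale1r scaler_sumr.
  by congr (_ + _); apply: eq_bigr => k _; rewrite scalerA -exprS.
by apply: cvgD; [exact: cvg_cst|exact: cvgZr].
Qed.

(** Since [D] shifts the coefficients, [D (psum x z)] is [D (x 0)] plus [z] times the original
    series. When [D (x 0) = 0], the sum is therefore a kernel vector of [D - z]. *)
Lemma psum_op (D : boundedOp Y Y) K rho x z : 0 <= rho -> geo_bound K rho x ->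
  nr z * rho < 1 -> (forall n, D (x n.+1) = x n) ->
  D (psum x z) - (z : R[i]) *: psum x z = D (x 0%N).
Proof.
move=> rho0 xK zrho Dx.
have [C C0 DC] := bounded_op_nr D.
have DxK : geo_bound (C * K) rho (D \o x).
  by move=> n; rewrite (le_trans (DC _))// -mulrA ler_wpM2l// ltW.
have -> : D (psum x z) = psum (D \o x) z.
  have [xs _] := psum_cvg rho0 xK zrho; have [ys _] := psum_cvg rho0 DxK zrho.
  apply: (cvgn_unique (cvg_bop D xs)).
  rewrite (_ : (fun n => _) = series (fun n => (z ^+ n : R[i]) *: (D \o x) n))//.
  apply/funext => n; rewrite /series /= linear_sum.
  by apply: eq_bigr => k _; rewrite linearZ.
rewrite (psum_recl rho0 DxK zrho) (_ : (D \o x) \o S = x) ?addrK//.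
by apply/funext => n /=.
Qed.

(* [recenter z0 x] is (1 - z0 L)^-1 x, where L is the backward shift. *)
Definition recenter z x : nat -> Y := fun n => psum (fun j => x (n + j)%N) z.

Lemma geo_bound_shift K rho x n : geo_bound K rho x ->
  geo_bound (K * rho ^+ n) rho (fun j => x (n + j)%N).
Proof. by move=> xK j; rewrite -mulrA -exprD; exact: xK. Qed.

Lemma recenter_bound K rho x z : 0 <= rho -> geo_bound K rho x ->
  nr z * rho < 1 -> geo_bound (K / (1 - nr z * rho)) rho (recenter z x).
Proof.
move=> rho0 xK zrho n.
have [_ /le_trans] := psum_cvg rho0 (geo_bound_shift n xK) zrho.
by apply; rewrite mulrAC.
Qed.

Lemma recenterE K rho x z n : 0 <= rho -> geo_bound K rho x -> nr z * rho < 1 ->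
  recenter z x n = x n + (z : R[i]) *: recenter z x n.+1.
Proof.
move=> rho0 xK zrho.
rewrite /recenter (psum_recl rho0 (geo_bound_shift n xK) zrho) addn0.
by congr (_ + _ *: psum _ _); apply/funext => j /=; rewrite addnS.
Qed.

(* With [y = (1 - z0 L)^-1 x] one has [x_n = y_n - z0 y_(n+1)]; iterating this
   identity gives the power series expansion at [z0]. *)
Lemma psum_recenter K rho x z0 z : 0 <= rho -> geo_bound K rho x ->
  nr z0 * rho < 1 -> nr z * rho < 1 ->
  psum x z = recenter z0 x 0%N +
    (z - z0 : R[i]) *: psum (recenter z0 x \o S) z.
Proof.
move=> rho0 xK z0rho zrho.
have yK := recenter_bound rho0 xK z0rho; set y := recenter z0 x in yK *.
have yK' : geo_bound (K / (1 - nr z0 * rho) * rho) rho (y \o S).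
  by move=> n; rewrite -mulrA -exprS; exact: yK.
have [xs _] := psum_cvg rho0 xK zrho.
have [ys _] := psum_cvg rho0 yK zrho.
have [ys' _] := psum_cvg rho0 yK' zrho.
have -> : psum x z = psum y z - (z0 : R[i]) *: psum (y \o S) z.
  apply: (cvgn_unique xs).
  rewrite (_ : series _ = (fun n => series (fun n => (z ^+ n : R[i]) *: y n) n -
    (z0 : R[i]) *: series (fun n => (z ^+ n : R[i]) *: (y \o S) n) n)); last first.
    apply/funext => n; rewrite /series /= scaler_sumr -sumrB.
    apply: eq_bigr => k _; rewrite scalerA (mulrC (z0 : R[i])) -scalerA -scalerBr.
    by rewrite /y (recenterE k rho0 xK z0rho) addrK.
  by apply: cvgB => //; exact: cvgZr.
by rewrite (psum_recl rho0 yK zrho) scalerBl addrA.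
Qed.

(** Analyticity at [z0] asks for an expansion around [z0] itself, obtained by iterating
    [psum_recenter]. The radius [(4 * rho)^-1] makes the remainder decay like [2^-n]. *)
Lemma analytic_psum K rho x (z0 p : Cplx R) : 0 < rho -> geo_bound K rho x ->
  nr (z0 - p) < (4 * rho)^-1 -> analytic_at (fun z => psum x (z - p)) z0.
Proof.
move=> rho0 xK z0p.
have rho0' := ltW rho0.
have r4 : 0 < (4 * rho)^-1 by rewrite invr_gt0 mulr_gt0.
have r4E : (4 * rho)^-1 * rho = 4^-1 by field; rewrite gt_eqF.
have z0rho : nr (z0 - p) * rho < 4^-1 by rewrite -r4E ltr_pM2r.
pose step (x : nat -> Y) := recenter (z0 - p) x \o S.
(* Each recentering costs a factor [1 / (1 - nr (z0 - p) * rho)], at most 2, and the shift that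
   follows costs [rho]. *)
have stepK m : geo_bound (K * (2 * rho) ^+ m) rho (iter m step x).
  elim: m => [|m IH]; first by rewrite expr0 mulr1.
  move=> n /=; have h : nr (z0 - p) * rho < 1 by lra.
  rewrite /step /= (le_trans (recenter_bound rho0' IH h n.+1))//.
  have -> : K * (2 * rho) ^+ m.+1 * rho ^+ n = 2 * (K * (2 * rho) ^+ m * rho ^+ n.+1).
    by rewrite !exprS; ring.
  rewrite mulrAC mulrC ler_wpM2r//.
    by rewrite mulr_ge0 ?exprn_ge0// (geo_bound_ge0 IH).
  by rewrite -[leRHS]invrK lef_pV2 ?posrE; lra.
exists (fun m => recenter (z0 - p) (iter m step x) 0%N).
apply/nr_nearP; exists (4 * rho)^-1 => // z zz0.
have zz0rho : nr (z - z0) * rho < 4^-1 by rewrite -r4E ltr_pM2r.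
have zrho : nr (z - p) * rho < 2^-1.
  apply: (@le_lt_trans _ _ ((nr (z - z0) + nr (z0 - p)) * rho)); last lra.
  by rewrite ler_wpM2r// ler_nr_distD.
(* The Taylor expansion with an exact remainder. *)
have expand n : psum x (z - p) = series (fun m => ((z - z0) ^+ m : R[i]) *:
    recenter (z0 - p) (iter m step x) 0%N) n +
    ((z - z0) ^+ n : R[i]) *: psum (iter n step x) (z - p).
  elim: n => [|n IH]; first by rewrite /series /= big_geq// expr0 add0r scale1r.
  rewrite IH seriesSr -addrA; congr (_ + _).
  rewrite (psum_recenter (z0 := z0 - p) rho0' (stepK n)); [|lra|lra].
  by rewrite scalerDr scalerA opprB addrA subrK -exprSr.
apply/cvg_nrP => e e0.
have [||N hN] := @geometric_small R (K * 2) 2^-1 _ _ e e0; [lra|lra|].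
exists N => n /hN; apply: le_lt_trans.
rewrite nr_distC (expand n) addrAC subrr add0r nrZ nrX.
have [|_ h] := psum_cvg rho0' (stepK n) (z := z - p); first lra.
have K0 := geo_bound_ge0 xK.
apply: (@le_trans _ _ (nr (z - z0) ^+ n * (K * (2 * rho) ^+ n * 2))).
  rewrite ler_wpM2l ?exprn_ge0 ?nr_ge0// (le_trans h)// ler_wpM2l//.
    by rewrite mulr_ge0// exprn_ge0// mulr_ge0.
  by rewrite -[leRHS]invrK lef_pV2 ?posrE; lra.
have -> : nr (z - z0) ^+ n * (K * (2 * rho) ^+ n * 2) =
    K * 2 * (nr (z - z0) * (2 * rho)) ^+ n by rewrite !exprMn; ring.
rewrite ler_wpM2l//; first by rewrite mulr_ge0.
rewrite lerXn2r// ?nnegrE ?mulr_ge0 ?nr_ge0//; lra.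
Qed.

(** The function [psum x (z - p)] is analytic near [p], takes its values in the kernel of [T - z],
    and equals [x 0] at [p]; the SVEP annihilates it. *)
Lemma SVEP_chain (T : boundedOp Y Y) (p : Cplx R) x K rho :
  SVEP_at T p -> 0 < rho -> geo_bound K rho x -> sub_scalar T p (x 0%N) = 0 ->
  (forall n, sub_scalar T p (x n.+1) = x n) -> x 0%N = 0.
Proof.
move=> svepT rho0 xK Dx0 Dx.
have r4 : 0 < (4 * rho)^-1 by rewrite invr_gt0 mulr_gt0.
have r4E : (4 * rho)^-1 * rho = 4^-1 by field; rewrite gt_eqF.
have := svepT (4 * rho)^-1%:C%C _ (fun z => psum x (z - p)) _ _ p.
rewrite ltcR => /(_ r4) h.
have -> : x 0%N = psum x (p - p).
  have h0 : nr (p - p) * rho < 1 by rewrite subrr nr0 mul0r.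
  by rewrite (psum_recl (ltW rho0) xK h0) subrr scale0r addr0.
apply: h => [z /nr_ball|z /nr_ball zp|].
- exact: analytic_psum.
- rewrite -Dx0 -(psum_op (ltW rho0) xK _ Dx (z := z - p)); last first.
    by apply: (@lt_trans _ _ 4^-1); [rewrite -r4E ltr_pM2r|lra].
  by rewrite !sub_scalarE scalerBl opprB addrA subrK.
- by apply/nr_ball; rewrite subrr nr0.
Qed.

End PowerSeries.

(** * The Hahn-Banach theorem *)

Section HahnBanach.
Context {R : realType}.

Section Sublinear.
Variable V : lmodType R[i].
Implicit Types (x y : V) (q : V -> R).

Local Notation "r ** x" := ((r%:C)%C *: x) (at level 40).

(** Homogeneity is asked only as an inequality, which passes easily to infima; equality follows in
    [sublinearZ]. *)
Definition sublinear q := (forall x y, q (x + y) <= q x + q y) /\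
  forall (r : R) x, 0 < r -> q (r ** x) <= r * q x.

Lemma sublinear0 q : sublinear q -> q 0 = 0.
Proof.
move=> [qD qZ]; have := qD 0 0; have := @qZ 2^-1 0.
by rewrite addr0 scaler0; lra.
Qed.

Lemma sublinearN q x : sublinear q -> - q (- x) <= q x.
Proof. by move=> sq; have := sq.1 x (- x); rewrite subrr (sublinear0 sq); lra. Qed.

Lemma scale_realK (r : R) x : 0 < r -> r^-1 ** (r ** x) = x.
Proof.
by move=> r0; rewrite scalerA -rmorphM mulVf ?gt_eqF//= scale1r.
Qed.

Lemma sublinearZ q (r : R) x : sublinear q -> 0 < r -> q (r ** x) = r * q x.
Proof.
move=> [_ qZ] r0; apply/eqP; rewrite eq_le qZ//=.
have := @qZ r^-1 (r ** x); rewrite invr_gt0 scale_realK// => /(_ r0).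
by rewrite -ler_pdivlMl// mulrC invrK.
Qed.

Lemma sublinear_inf (F : V -> set R) :
  (forall x, F x !=set0) -> (forall x, has_lbound (F x)) ->
  (forall x y a b, F x a -> F y b -> exists2 c, F (x + y) c & c <= a + b) ->
  (forall (r : R) x a, 0 < r -> F x a -> exists2 c, F (r ** x) c & c <= r * a) ->
  sublinear (fun x => inf (F x)).
Proof.
move=> F0 Fl FD FZ; have Fi x : has_inf (F x) by split.
split=> [x y|r x r0].
  apply/ler_addgt0Pr => e e0; have e2 : 0 < e / 2 by rewrite divr_gt0.
  have [a Fa ae] := inf_adherent e2 (Fi x).
  have [b Fb be] := inf_adherent e2 (Fi y).
  have [c Fc cab] := FD _ _ _ _ Fa Fb.
  by have := ge_inf (Fl (x + y)) Fc; lra.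
rewrite -ler_pdivrMl//; apply: lb_le_inf => // a Fa.
have [c Fc ca] := FZ r x a r0 Fa.
by rewrite ler_pdivrMl// (le_trans (ge_inf (Fl _) Fc)).
Qed.

(* [z |-> inf_(t >= 0) q (z + t y) - t q y] is sublinear and below [q], so it
   equals [q]; take [t = 1]. *)
Lemma minimal_sublinear_additive q : sublinear q ->
  (forall q', sublinear q' -> (forall x, q' x <= q x) -> q' = q) ->
  {morph q : x y / x + y}.
Proof.
move=> sq qmin x y; apply/eqP; rewrite eq_le sq.1 /=.
pose F z : set R := [set q (z + t ** y) - t * q y | t in [set t | 0 <= t]].
have Fl z : has_lbound (F z).
  exists (- q (- z)) => _ [t /= t0 <-].
  have := sq.1 (- z) (z + t ** y); rewrite addKr.
  suff -> : q (t ** y) = t * q y by lra.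
  move: t0; rewrite le_eqVlt => /predU1P[<-|t0]; last exact: sublinearZ.
  by rewrite scale0r (sublinear0 sq) mul0r.
have F0 z : F z (q z) by exists 0 => //=; rewrite scale0r addr0 mul0r subr0.
have /qmin : sublinear (fun z => inf (F z)).
  apply: sublinear_inf =>
    //= [z|z w _ _ [s /= s0 <-] [t /= t0 <-]|r z _ r0 [s /= s0 <-]].
  - by exists (q z).
  - exists (q (z + w + (s + t) ** y) - (s + t) * q y).
      by exists (s + t) => //=; rewrite addr_ge0.
    rewrite rmorphD scalerDl addrACA.
    by have := sq.1 (z + s ** y) (w + t ** y); lra.
  - exists (q (r ** z + (r * s) ** y) - (r * s) * q y).
      by exists (r * s) => //=; rewrite mulr_ge0// ltW.
    rewrite rmorphM /= -scalerA -scalerDr sublinearZ//.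
    by rewrite mulrBr mulrA.
move=> /(_ (fun z => ge_inf (Fl z) (F0 z)))/(congr1 (fun f => f x)) <-.
have := @ge_inf _ (F x) (Fl x) (q (x + y) - q y).
rewrite -lerBrDr; apply; exists 1 => //=; by rewrite scale1r mul1r.
Qed.

(** Zorn's lemma for the reversed pointwise order: a nonempty chain is bounded by its pointwise
    infimum, which is finite because [- p (- x)] bounds every member from below. *)
Lemma minimal_sublinear p : sublinear p -> exists q, [/\ sublinear q,
  forall x, q x <= p x &
  forall q', sublinear q' -> (forall x, q' x <= q x) -> q' = q].
Proof.
move=> sp; pose T := {q : V -> R | sublinear q /\ forall x, q x <= p x}.
pose below (s t : T) := `[< forall x, sval t x <= sval s x >].
have [|r s t /asboolP rs /asboolP st|s t /asboolP st /asboolP ts|A tA|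
      [q [sq qp]] qmin] :=
    @Zorn T below.
- by move=> t; apply/asboolP.
- by apply/asboolP => x; apply: (le_trans (st x)).
- case: s t st ts => [q hq] [q' hq'] /= st ts; apply: eq_exist.
  by apply/funext => x; apply/eqP; rewrite eq_le st ts.
- have [->|/set0P[q0 Aq0]] := eqVneq A set0.
    by exists (exist (fun q => sublinear q /\ forall x, q x <= p x) p
      (conj sp (fun x => lexx _))).
  pose F x : set R := [set sval q x | q in A].
  have Fl x : has_lbound (F x).
    exists (- p (- x)) => _ [q Aq <-]; have [sq qp] := svalP q.
    by rewrite (le_trans _ (sublinearN _ sq))// lerN2.
  have sF : sublinear (fun x => inf (F x)).
    apply: sublinear_inf => //= [x|x y _ _ [q Aq <-] [q' Aq' <-]|r x _ r0 [q Aq <-]].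
    + by exists (sval q0 x), q0.
    + have [/asboolP qq'|/asboolP qq'] := tA _ _ Aq Aq'.
        exists (sval q' (x + y)); first by exists q'.
        by rewrite (le_trans ((svalP q').1.1 x y))// lerD2r.
      exists (sval q (x + y)); first by exists q.
      by rewrite (le_trans ((svalP q).1.1 x y))// lerD2l.
    + by exists (sval q (r ** x)); [exists q|exact: (svalP q).1.2].
  have Fp x : inf (F x) <= p x.
    by apply: (le_trans (ge_inf (Fl x) _)) ((svalP q0).2 x); exists q0.
  exists (exist (fun q => sublinear q /\ forall x, q x <= p x) _ (conj sF Fp)).
  move=> q Aq; apply/asboolP => x /=.
  by apply: (ge_inf (Fl x)); exists q.
- exists q; split=> // q' sq' q'q.
  have q'p x : q' x <= p x by exact: le_trans (q'q x) (qp x).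
  have := qmin (exist (fun q => sublinear q /\ forall x, q x <= p x) _
    (conj sq' q'p)).
  by rewrite /below /= => /(_ (asboolT q'q))/(congr1 sval).
Qed.

(** The infimum of [p (x - g) + f g] over [g] in [G] is sublinear, lies below [p], and lies below
    [f] on [G]. A minimal sublinear [L] under it is additive, hence odd, so [L <= f] on [G] applied
    to [x] and [- x] gives equality. *)
Lemma real_hahn_banach p (G : set V) (f : V -> R) : sublinear p ->
  (forall x y, G x -> G y -> G (x + y) /\ f (x + y) = f x + f y) ->
  (forall (r : R) x, G x -> G (r ** x) /\ f (r ** x) = r * f x) ->
  G 0 -> (forall x, G x -> f x <= p x) ->
  exists L : V -> R, [/\ {morph L : x y / x + y},
    forall (r : R) x, L (r ** x) = r * L x,
    forall x, L x <= p x & forall x, G x -> L x = f x].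
Proof.
move=> sp GD GZ G0 fp.
have GN x : G x -> G (- x) /\ f (- x) = - f x.
  by move=> /(GZ (-1)); rewrite rmorphN scaleN1r mulN1r.
have f0 : f 0 = 0 by have [] := GZ 0 0 G0; rewrite scaler0 mul0r.
pose F x : set R := [set p (x - g) + f g | g in G].
have Fl x : has_lbound (F x).
  exists (- p (- x)) => _ [g Gg <-]; have [GNg fN] := GN g Gg.
  have := sp.1 (- x) (x - g); have := fp _ GNg; rewrite addKr fN; lra.
have sF : sublinear (fun x => inf (F x)).
  apply: sublinear_inf => //= [x|x y _ _ [g Gg <-] [h Gh <-]|r x _ r0 [g Gg <-]].
  - by exists (p (x - 0) + f 0), 0.
  - have [Ggh fgh] := GD _ _ Gg Gh.
    exists (p (x + y - (g + h)) + f (g + h)); first by exists (g + h).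
    by have := sp.1 (x - g) (y - h); rewrite fgh opprD addrACA; lra.
  - have [Grg frg] := GZ r _ Gg.
    exists (p (r ** x - r ** g) + f (r ** g)); first by exists (r ** g).
    by rewrite frg -scalerBr sublinearZ// mulrDr.
have [L [sL LF /(minimal_sublinear_additive sL) LD]] := minimal_sublinear sF.
have L0 := sublinear0 sL.
have LN x : L (- x) = - L x.
  by apply/eqP; rewrite -addr_eq0 -LD addNr L0.
have Lp x : L x <= p x.
  apply: (le_trans (LF x)); apply: (ge_inf (Fl x)).
  by exists 0 => //; rewrite subr0 f0 addr0.
have Lf x : G x -> L x <= f x.
  move=> Gx; apply: (le_trans (LF x)); apply: (ge_inf (Fl x)).
  by exists x => //; rewrite subrr (sublinear0 sp) add0r.
exists L; split=> // [r x|x Gx].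
  have [r0|r0|<-] := ltgtP 0 r; last by rewrite scale0r L0 mul0r.
    exact: sublinearZ.
  apply: oppr_inj; rewrite -LN -scaleNr -rmorphN -mulNr; apply: sublinearZ => //.
  by rewrite oppr_gt0.
apply/eqP; rewrite eq_le Lf//=.
by have [GNx fN] := GN x Gx; have := Lf _ GNx; rewrite fN LN lerN2.
Qed.

End Sublinear.

(* Bounding real and imaginary parts separately gives [2 C] instead of the sharp
   constant [C]. *)
Lemma hahn_banach (V : normedModType R[i]) (G : set V) (phi : V -> Cplx R)
    (C : R) :
  G 0 ->
  (forall (a : R[i]) x y, G x -> G y ->
     G (a *: x + y) /\ phi (a *: x + y) = (a : Cplx R) * phi x + phi y) ->
  (forall x, G x -> nr (phi x) <= C * nr x) -> 0 <= C ->
  exists2 psi : boundedOp V (Cplx R),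
    forall x, G x -> psi x = phi x & forall x, nr (psi x) <= 2 * C * nr x.
Proof.
move=> G0 GP phiC C0.
have phi0 : phi 0 = 0.
  have [_] := GP (-1) 0 0 G0 G0.
  by rewrite scaler0 addr0 mulN1r addNr.
have GD x y : G x -> G y -> G (x + y) /\ phi (x + y) = phi x + phi y.
  by move=> Gx Gy; have := GP 1 x y Gx Gy; rewrite scale1r mul1r.
have GZ (a : R[i]) x : G x -> G (a *: x) /\ phi (a *: x) = (a : Cplx R) * phi x.
  by move=> Gx; have := GP a x 0 Gx G0; rewrite phi0 !addr0.
have [|||||L [LD LZ Lp Lphi]] := @real_hahn_banach V (fun x => C * nr x) G
    (fun x => complex.Re (phi x)).
- split=> [x y|r x r0]; first by rewrite -mulrDr ler_wpM2l// ler_nrD.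
  by rewrite nrZ nr_real gtr0_norm// mulrCA.
- by move=> x y Gx Gy; have [? ->] := GD x y Gx Gy; rewrite raddfD.
- move=> r x Gx; have [? ->] := GZ r%:C%C x Gx; split=> //.
  by case: (phi x) => a b /=; rewrite mul0r subr0.
- by [].
- move=> x Gx; apply: le_trans (phiC x Gx).
  exact: le_trans (ler_norm _) (nr_ge_Re _).
have Li x : L ('i%C *: ('i%C *: x)) = - L x.
  rewrite scalerA -expr2 sqr_i (_ : -1 = ((-1)%:C)%C) ?LZ ?mulN1r//.
  by rewrite rmorphN.
(* The complex functional whose real part is [L]. *)
pose psi x : Cplx R := (L x -i* L ('i%C *: x))%C.
have La (a : R[i]) x :
    L (a *: x) = complex.Re a * L x + complex.Im a * L ('i%C *: x).
  by rewrite {1}(complexE a) scalerDl LD LZ (mulrC 'i%C) -scalerA LZ.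
have lpsi : linear psi.
  move=> a x y; rewrite /psi.
  have -> : 'i%C *: (a *: x + y) = a *: ('i%C *: x) + 'i%C *: y.
    by rewrite scalerDr !scalerA (mulrC 'i%C).
  rewrite !LD (La a x) (La a ('i%C *: x)) Li.
  case: a => a b.
  apply/eqP; rewrite eq_complex; apply/andP; split; apply/eqP => /=; ring.
have Lb x : `|L x| <= C * nr x.
  rewrite ler_norml Lp andbT lerNl -(nrN x).
  suff <- : L (- x) = - L x by exact: Lp.
  by rewrite -scaleN1r (_ : -1 = ((-1)%:C)%C) ?LZ ?mulN1r// rmorphN.
have psiC x : nr (psi x) <= 2 * C * nr x.
  apply: (le_trans (nr_le_ReIm _)); rewrite /psi /= normrN.
  have := Lb x; have := Lb ('i%C *: x).
  rewrite nrZ (_ : nr ('i%C : Cplx R) = 1) ?mul1r; last first.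
    by rewrite -[in LHS](mulr1 'i%C) nr_mulil (nr_real 1) normr1.
  by lra.
have [T TE] := linear_bounded_op lpsi psiC.
exists T => [x Gx|x]; last by rewrite TE.
have [Gix phii] := GZ 'i%C x Gx.
rewrite TE /psi !Lphi// phii; case: (phi x) => a b /=.
by rewrite mul0r mul1r sub0r opprK.
Qed.

End HahnBanach.

(** * Poles of the resolvent *)

Section Pole.
Context {R : realType}.

Lemma geo_bound_cvg (V : normedModType R[i]) (a : nat -> V) (w l : V)
    (z : Cplx R) : 0 < nr z ->
  series (fun n => (z ^+ n : R[i]) *: a n) @ \oo --> l ->
  exists K, geo_bound K (nr z)^-1 a.
Proof.
move=> z0 /cvg_nrP/(_ 1 ltr01)[N hN]; set u := fun n => _ in hN.
have u0 n : 0 <= nr (u n) by exact: nr_ge0.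
(* From [N] on, two consecutive partial sums are within 1 of the limit, so the terms are below 2;
   the sum covers the earlier terms. *)
exists (2 + \sum_(k < N) nr (u k)) => n.
rewrite exprVn ler_pdivlMr ?exprn_gt0// mulrC -nrX -nrZ -/(u n).
have [nN|Nn] := ltnP n N.
  by rewrite (bigD1 (Ordinal nN))//= addrCA lerDl addr_ge0// sumr_ge0.
apply: (@le_trans _ _ 2); last by rewrite lerDl sumr_ge0.
have := hN n Nn; have := hN n.+1 (leqW Nn); rewrite seriesSr.
have := ler_nr_distD l (series u n + u n) (series u n).
by rewrite addrAC subrr add0r (nr_distC l); lra.
Qed.

Variables (Y : normedModType R[i]) (cY : seq_complete Y).
Implicit Types (x y : nat -> Y) (z w : Cplx R).

Lemma psumB K K' rho x y z : 0 <= rho -> geo_bound K rho x ->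
  geo_bound K' rho y -> nr z * rho < 1 ->
  psum (fun n => x n - y n) z = psum x z - psum y z.
Proof.
move=> rho0 xK yK zrho.
have [xs _] := psum_cvg cY rho0 xK zrho.
have [ys _] := psum_cvg cY rho0 yK zrho.
have xyK : geo_bound (K + K') rho (fun n => x n - y n).
  by move=> n; rewrite mulrDl (le_trans (ler_nrB _ _))// lerD.
have [xys _] := psum_cvg cY rho0 xyK zrho.
apply: (cvgn_unique xys).
rewrite (_ : series _ = (fun n => series (fun n => (z ^+ n : R[i]) *: x n) n -
    series (fun n => (z ^+ n : R[i]) *: y n) n)); first exact: cvgB.
apply/funext => n; rewrite /series /= -sumrB.
by apply: eq_bigr => k _; rewrite scalerBr.
Qed.

(** The identity theorem on a punctured disc: the constant coefficient equals [- w] times a bounded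
    function of [w], so it is 0; dividing by [w] then passes to the shifted series. *)
Lemma psum_inj0 K rho x : 0 < rho -> geo_bound K rho x ->
  (exists2 r : R, 0 < r & forall w, w != 0 -> nr w < r -> psum x w = 0) ->
  forall n, x n = 0.
Proof.
move=> rho0 + [r0 r00 hx] n.
pose r := Num.min r0 (2 * rho)^-1.
have r_gt0 : 0 < r by rewrite lt_min r00 invr_gt0 mulr_gt0.
have r2E : (2 * rho)^-1 * rho = 2^-1 by field; rewrite gt_eqF.
have {}hx w : w != 0 -> nr w < r -> psum x w = 0.
  by move=> w0; rewrite lt_min => /andP[wr _]; exact: hx.
have {r00} rrho w : nr w < r -> nr w * rho < 2^-1.
  by rewrite lt_min -r2E => /andP[_ wr]; rewrite ltr_pM2r.
have zero K' y : geo_bound K' rho y ->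
    (forall w, w != 0 -> nr w < r -> psum y w = 0) ->
    y 0%N = 0 /\ forall w, w != 0 -> nr w < r -> psum (y \o S) w = 0.
  move=> yK hy; have K0 := geo_bound_ge0 yK.
  have rec w : w != 0 -> nr w < r -> y 0%N = - ((w : R[i]) *: psum (y \o S) w).
    move=> w0 wr; have w1 : nr w * rho < 1 by have := rrho _ wr; lra.
    have := psum_recl cY (ltW rho0) yK w1.
    by rewrite (hy w w0 wr) => /esym/eqP; rewrite addr_eq0 => /eqP.
  have yK' : geo_bound (K' * rho) rho (y \o S).
    by move=> j; rewrite -mulrA -exprS; exact: yK.
  have y0 : y 0%N = 0.
    apply/eqP; apply: contrapT => /negP/nr_gt0 t0; set t := nr _ in t0.
    pose M := K' * rho * 2; have M0 : 0 <= M by rewrite !mulr_ge0// ltW.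
    (* Small enough that [s * M < t], where [M] bounds the shifted series on the disc. *)
    pose s := Num.min (r / 2) (t / (2 * (M + 1))).
    have M1 : 0 < 2 * (M + 1) by lra.
    have s0 : 0 < s by rewrite lt_min !divr_gt0.
    have ns : nr (s%:C%C : Cplx R) = s by rewrite nr_real gtr0_norm.
    have sr : s < r by rewrite gt_min; apply/orP; left; lra.
    have st : s * (2 * (M + 1)) <= t.
      by rewrite -ler_pdivlMr// ge_min lexx orbT.
    have sneq : (s%:C%C : Cplx R) != 0.
      by apply/eqP => /(congr1 nr); rewrite ns nr0; lra.
    have sr' : nr (s%:C%C : Cplx R) < r by rewrite ns.
    have ps : nr (psum (y \o S) s%:C%C) <= M.
      have h : nr (s%:C%C : Cplx R) * rho < 1 by have := rrho _ sr'; lra.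
      have [_ /le_trans] := psum_cvg cY (ltW rho0) yK' h; apply.
      rewrite ler_wpM2l ?(mulr_ge0 K0 (ltW rho0))//.
      by rewrite -[leRHS]invrK lef_pV2 ?posrE; have := rrho _ sr'; lra.
    have : t <= s * M.
      by rewrite /t (rec _ sneq sr') nrN nrZ ns ler_wpM2l// ltW.
    by nra.
  split=> // w w0 wr; have /eqP := rec w w0 wr.
  by rewrite y0 eq_sym oppr_eq0 scaler_eq0 (negbTE w0) => /eqP.
elim: n K x hx => [|n IH] K x hx xK; have [x0 hx'] := zero _ _ xK hx; first by [].
apply: (IH (K * rho) (x \o S)) => // j.
by rewrite -mulrA -exprS; exact: xK.
Qed.

(** In terms of power series, [shiftr] multiplies by the variable and [pulse k v] is the monomial of
    degree [k] with coefficient [v]. *)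
Definition shiftr x : nat -> Y := fun n => if n is m.+1 then x m else 0.
Definition pulse k (v : Y) : nat -> Y := fun n => if n == k then v else 0.

Lemma shiftr_bound K rho x : 0 < rho -> geo_bound K rho x ->
  geo_bound (K / rho) rho (shiftr x).
Proof.
move=> rho0 xK [|n] /=.
  by rewrite nr0 expr0 mulr1 divr_ge0 ?(geo_bound_ge0 xK)// ltW.
by rewrite exprS mulrA divfK ?gt_eqF.
Qed.

Lemma psum_shiftr K rho x z : 0 < rho -> geo_bound K rho x -> nr z * rho < 1 ->
  psum (shiftr x) z = (z : R[i]) *: psum x z.
Proof.
move=> rho0 xK zrho.
rewrite (psum_recl cY (ltW rho0) (shiftr_bound rho0 xK) zrho) add0r.
by congr (_ *: psum _ _); apply/funext.
Qed.

Lemma pulse_bound rho k v : 0 < rho -> geo_bound (nr v / rho ^+ k) rho (pulse k v).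
Proof.
move=> rho0 n; rewrite /pulse; case: eqP => [->|_].
  by rewrite divfK// gt_eqF// exprn_gt0.
by rewrite nr0 mulr_ge0// ?divr_ge0 ?nr_ge0 ?exprn_ge0// ltW.
Qed.

Lemma psum_pulse rho k v z : 0 < rho -> nr z * rho < 1 ->
  psum (pulse k v) z = (z ^+ k : R[i]) *: v.
Proof.
move=> rho0 zrho; elim: k => [|k IH].
  rewrite (psum_recl cY (ltW rho0) (pulse_bound 0 v rho0) zrho) /pulse eqxx.
  rewrite expr0 scale1r -[RHS]addr0; congr (_ + _).
  have -> : (fun n => if n == 0%N then v else 0) \o S = fun=> 0 by [].
  rewrite (_ : psum _ _ = 0) ?scaler0//; apply: cvg_lim => //.
  rewrite (_ : series _ = fun=> 0); first exact: cvg_cst.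
  by apply/funext => n; rewrite /series /= big1// => i _; rewrite scaler0.
have -> : pulse k.+1 v = shiftr (pulse k v) by apply/funext => -[|n].
by rewrite (psum_shiftr rho0 (pulse_bound k v rho0) zrho) IH scalerA -exprS.
Qed.

(** The identity theorem applied to [y - shiftr x - pulse k v] turns a functional equation into a
    recursion on coefficients. *)
Lemma psum_coef K K' rho x y k v : 0 < rho -> geo_bound K rho x ->
  geo_bound K' rho y ->
  (exists2 r : R, 0 < r & forall w, w != 0 -> nr w < r ->
     psum y w - (w : R[i]) *: psum x w = (w ^+ k : R[i]) *: v) ->
  forall n, y n = shiftr x n + pulse k v n.
Proof.
move=> rho0 xK yK [r r0 hr] n.
have sK := shiftr_bound rho0 xK; have pK := pulse_bound k v rho0.
have ysK : geo_bound (K' + K / rho) rho (fun n => y n - shiftr x n).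
  by move=> m; rewrite mulrDl (le_trans (ler_nrB _ _))// lerD// sK.
have yspK : geo_bound (K' + K / rho + nr v / rho ^+ k) rho
    (fun n => y n - shiftr x n - pulse k v n).
  by move=> m; rewrite mulrDl (le_trans (ler_nrB _ _))// lerD// pK.
suff : y n - shiftr x n - pulse k v n = 0.
  by move/eqP; rewrite subr_eq add0r subr_eq [_ + shiftr x n]addrC => /eqP.
apply: (psum_inj0 rho0 yspK).
exists (Num.min r rho^-1); first by rewrite lt_min r0 invr_gt0.
move=> w w0; rewrite lt_min => /andP[wr wrho].
have w1 : nr w * rho < 1 by rewrite -ltr_pdivlMr// mul1r.
rewrite (psumB (ltW rho0) ysK pK w1) (psumB (ltW rho0) yK sK w1).
by rewrite (psum_shiftr rho0 xK w1) (psum_pulse k v rho0 w1) hr// subrr.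
Qed.

(* With [A = T - l] and [g] the analytic factor of the resolvent, comparing
   coefficients in [(A - w) g(l + w) = w^k = g(l + w) (A - w)] shows that [b],
   the coefficient of order [k] of [g], behaves as a Drazin inverse of [A]. *)
Lemma pole_drazin (T : boundedOp Y Y) (l : Cplx R) : resolvent_pole T l ->
  exists k (b : boundedOp Y Y), b * sub_scalar T l = sub_scalar T l * b /\
    forall v, (sub_scalar T l ^+ k.+1) (b v) = (sub_scalar T l ^+ k) v.
Proof.
move=> [[_ [U /nr_nearP[r1 r10 Ur] UE]] [k [g [k0 [a /nr_nearP[r2 r20 ga]] _ Rg]]]].
have {Rg} [r3 r30 Rg] : exists2 r3 : R, 0 < r3 & forall z, nr (z - l) < r3 ->
    z != l -> resolvent T z = ((z - l) ^- k : R[i]) *: g z.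
  by move: Rg; rewrite near_withinE => /nr_nearP.
pose r := Num.min r1 (Num.min r2 r3) / 2.
have r0 : 0 < r by rewrite divr_gt0// !lt_min r10 r20.
have [rr1 rr2 rr3] : [/\ r < r1, r < r2 & r < r3].
  have h : r < Num.min r1 (Num.min r2 r3) by rewrite /r; move: r0; rewrite /r; lra.
  by move: h; rewrite !lt_min => /andP[? /andP[]].
set A := sub_scalar T l.
have AE v : A v = T v - (l : R[i]) *: v by [].
clearbody A.
have nrr : nr (r%:C%C : Cplx R) = r by rewrite nr_real gtr0_norm.
(* Convergence at the single point [l + r] bounds the coefficients of [g] geometrically with ratio
   [r^-1]. *)
have [K aK] : exists K, geo_bound K r^-1 a.
  rewrite -nrr; apply: (@geo_bound_cvg _ a (g (l + r%:C%C))); first by rewrite nrr.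
  have := ga (l + r%:C%C); rewrite addrAC subrr add0r nrr; exact.
have rV : 0 < r^-1 by rewrite invr_gt0.
have avK v : geo_bound (K * nr v) r^-1 (fun n => a n v).
  move=> n; rewrite mulrAC (le_trans (nr_bop _ _))// ler_wpM2r ?nr_ge0//; exact: aK.
have AavK v : exists K', geo_bound K' r^-1 (fun n => A (a n v)).
  have [C C0 AC] := bounded_op_nr A; exists (C * (K * nr v)) => n.
  by rewrite (le_trans (AC _))// -mulrA ler_wpM2l//; [exact: ltW|exact: avK].
have gs v (w : Cplx R) : nr w < r ->
    series (fun n => (w ^+ n : R[i]) *: a n v) @ \oo --> g (l + w) v.
  move=> wr; have := ga (l + w); rewrite addrAC subrr add0r.
  move=> /(_ (lt_trans wr rr2))/cvg_nrP h; apply/cvg_nrP => e e0.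
  have v1 : 0 < nr v + 1 by rewrite ltr_wpDl// nr_ge0.
  have [N hN] := h _ (divr_gt0 e0 v1).
  exists N => n /hN; rewrite ltr_pdivlMr//; apply: le_lt_trans.
  apply: (@le_trans _ _
    (nr (series (fun n => (w ^+ n : R[i]) *: a n) n - g (l + w)) * nr v)).
    apply: le_trans (nr_bop _ _); rewrite add_bopE opp_bopE.
    rewrite (_ : (series _ n : boundedOp Y Y) v =
      series (fun n => (w ^+ n : R[i]) *: a n v) n)//.
    elim: n {hN} => [|n IH]; first by rewrite /series /= !big_geq.
    by rewrite !seriesSr add_bopE IH.
  by rewrite ler_wpM2l ?nr_ge0// lerDl.
have gp v (w : Cplx R) : nr w < r -> psum (fun n => a n v) w = g (l + w) v.
  by move=> wr; apply: cvg_lim => //; exact: gs.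
have gAp v (w : Cplx R) : nr w < r -> psum (fun n => A (a n v)) w = A (g (l + w) v).
  move=> wr; apply: cvg_lim => //.
  rewrite (_ : series _ = (fun n => A (series (fun n => (w ^+ n : R[i]) *: a n v) n))).
    exact: cvg_bop (gs v w wr).
  apply/funext => n; rewrite /series /= linear_sum.
  by apply: eq_bigr => i _; rewrite linearZ.
(* Since [l] is isolated in the spectrum, the resolvent at [l + w] is a true inverse and not the
   default value 0. *)
have inv (w : Cplx R) : w != 0 -> nr w < r -> exists Rw : boundedOp Y Y,
    [/\ g (l + w) = (w ^+ k : R[i]) *: Rw,
     forall v, A (Rw v) - (w : R[i]) *: Rw v = v &
     forall v, Rw (A v) - (w : R[i]) *: Rw v = v].
  move=> w0 wr; have lw : l + w != l by rewrite -subr_eq0 addrAC subrr add0r.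
  have lwE : l + w - l = w by rewrite addrAC subrr add0r.
  exists (resolvent T (l + w)).
  have [h1 h2] : is_inverse (sub_scalar T (l + w)) (resolvent T (l + w)).
    apply: (@xgetPex _ 0 [set U | is_inverse (sub_scalar T (l + w)) U]).
    apply: contrapT => sp; have : [set l] (l + w).
      rewrite -UE; split=> //; apply: Ur; rewrite lwE; exact: lt_trans rr1.
    by move/eqP; rewrite (negbTE lw).
  have subE v : sub_scalar T (l + w) v = A v - (w : R[i]) *: v.
    by rewrite sub_scalarE AE scalerDl opprD addrA.
  split.
  - rewrite Rg ?lwE//; last exact: lt_trans rr3.
    by rewrite scalerA divff ?scale1r// expf_neq0.
  - by move=> v; rewrite -subE -mul_bopE h1.
  - move=> v; rewrite -[RHS]/((1 : boundedOp Y Y) v) -h2 mul_bopE subE.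
    by rewrite [RHS]linearB [in RHS]linearZ.
(* With [a_(-1) = 0], this reads [A a_n = a_(n-1)], plus the identity when [n = k]; [right] gives
   the same value for [a_n A], whence commutation. *)
have left v n : A (a n v) = shiftr (fun n => a n v) n + pulse k v n.
  have [K' AK] := AavK v; apply: (psum_coef rV (avK v) AK) => //.
  exists r => // w w0 wr; rewrite gAp// gp//.
  have [Rw [-> h _]] := inv w w0 wr.
  by rewrite scale_bopE linearZ /= scalerA mulrC -scalerA -scalerBr h.
have right v n : a n (A v) = shiftr (fun n => a n v) n + pulse k v n.
  apply: (psum_coef rV (avK v) (avK (A v))) => //.
  exists r => // w w0 wr; rewrite !gp//.
  have [Rw [-> _ h]] := inv w w0 wr.
  by rewrite !scale_bopE scalerA mulrC -scalerA -scalerBr h.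
exists k, (a k); split; first by apply: boundedOpP => v; rewrite !mul_bopE left right.
(* Below order [k] the recursion descends to 0. As [k > 0], the case [j = k - 1] removes the extra
   term in [A^(k+1) a_k = A^k (a_(k-1) + 1)]. *)
have Aa0 v j : (j < k)%N -> (A ^+ j.+1) (a j v) = 0.
  elim: j => [|j IH] jk; first by rewrite expr1 left /pulse ltn_eqF// addr0.
  by rewrite exprSr mul_bopE left /pulse ltn_eqF// addr0 /= IH// ltnW.
move=> v; rewrite exprSr mul_bopE left /pulse eqxx linearD /=.
by case: k k0 Aa0 {gp gAp left right inv Rg} => // k _ ->; rewrite ?add0r.
Qed.

Lemma meromorphic_drazin (T : boundedOp Y Y) (l : Cplx R) : meromorphic T ->
  l != 0 ->
  exists k (b : boundedOp Y Y), b * sub_scalar T l = sub_scalar T l * b /\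
    forall v, (sub_scalar T l ^+ k.+1) (b v) = (sub_scalar T l ^+ k) v.
Proof.
move=> mT l0; have [sp|] := pselect (spectrum T l); first exact/pole_drazin/mT.
move=> /contrapT[b [h1 h2]]; exists 0%N, b; rewrite h1 h2; split=> // v.
by rewrite expr1 -mul_bopE h1.
Qed.

End Pole.

(** * Kato operators and perturbation *)

Section Kato.
Context {R : realType} (Y : normedModType R[i]) (cY : seq_complete Y).
Variable D : boundedOp Y Y.
Hypothesis kD : Kato D.

(** Any two preimages of [D x] differ by a kernel vector, which a Kato operator has in every range.
    Backward orbits can thus be continued forever. *)
Lemma kato_preimage x : (forall n, range (D ^+ n) (D x)) ->
  forall n, range (D ^+ n) x.
Proof.
move=> Dx n; have [z _ zx] := Dx n.+1.
have [|w _ wx] := kD.2 n (x - (D ^+ n) z).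
  by rewrite /op_kernel /= linearB /= -mul_bopE -exprS zx subrr.
by exists (w + z) => //; rewrite linearD /= wx subrK.
Qed.

(** The selection [g] comes from choice and need not be linear. *)
Lemma kato_open : exists2 C : R, 0 < C &
  exists g : Y -> Y, forall y, range D y -> D (g y) = y /\ nr (g y) <= C * nr y.
Proof.
have [C C0 hC] := open_mapping cY cY kD.1.
exists C => //; suff /choice[g hg] : forall y, exists x, range D y ->
    D x = y /\ nr x <= C * nr y by exists g.
move=> y; have [Dy|] := pselect (range D y); last by exists 0.
by have [x xy xC] := hC y Dy; exists x.
Qed.

Lemma kato_chain v : D v = 0 -> exists (x : nat -> Y) (K C : R),
  [/\ 0 < C, geo_bound K C x, x 0%N = v & forall n, D (x n.+1) = x n].
Proof.
have [C C0 [g hg]] := kato_open; move=> Dv.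
have xr n : forall m, range (D ^+ m) (iter n g v).
  elim: n => [m|n IH]; first exact: kD.2.
  apply: kato_preimage => m; have [|-> _] := hg (iter n g v); last exact: IH.
  by have := IH 1%N; rewrite expr1.
have xD n : range D (iter n g v) by have := xr n 1%N; rewrite expr1.
exists (fun n => iter n g v), (nr v), C; split=> // [n|n].
  elim: n => [|n IH]; first by rewrite expr0 mulr1.
  by rewrite exprS mulrCA (le_trans (proj2 (hg _ (xD n))))// ler_wpM2l// ltW.
exact: (proj1 (hg _ (xD n))).
Qed.

(** On the range, [phi \o g] does not depend on the choice of preimages because [phi] kills the
    kernel, so it is linear and bounded. Its extension by [hahn_banach] accounts for the factor
    2. *)
Lemma kato_dual_lift : exists2 C : R, 0 < C &
  forall phi : boundedOp Y (Cplx R), (forall x, D x = 0 -> phi x = 0) ->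
  exists2 psi : boundedOp Y (Cplx R), forall x, psi (D x) = phi x &
    nr psi <= C * nr phi.
Proof.
have [C C0 [g hg]] := kato_open; exists (2 * C); first by rewrite mulr_gt0.
move=> phi phiD.
have phig x y : D x = D y -> phi x = phi y.
  move=> xy; apply/eqP; rewrite -subr_eq0 -linearB /= phiD//.
  by rewrite linearB /= xy subrr.
have [||y Dy||psi psiE psiC] :=
  @hahn_banach R Y (range D) (fun y => phi (g y)) (nr phi * C).
- by exists 0 => //; rewrite linear0.
- move=> a x y Dx Dy.
  have Daxy : range D (a *: x + y).
    by case: Dx => x' _ <-; case: Dy => y' _ <-; exists (a *: x' + y'); rewrite ?linearP.
  split=> //; rewrite -[a * _]/((a : R[i]) *: phi (g x)) -linearP; apply: phig.
  by rewrite linearP /= (proj1 (hg _ Daxy)) (proj1 (hg _ Dx)) (proj1 (hg _ Dy)).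
- rewrite (le_trans (nr_bop _ _))// -mulrA ler_wpM2l ?nr_ge0//.
  exact: (proj2 (hg _ Dy)).
- by rewrite mulr_ge0 ?nr_ge0// ltW.
exists psi => [x|].
  have Dx : range D (D x) by exists x.
  by rewrite psiE//; apply: phig; exact: (proj1 (hg _ Dx)).
apply: nr_bop_le => [|x]; first by rewrite !mulr_ge0 ?nr_ge0// ltW.
by rewrite (le_trans (psiC x))// -!mulrA (mulrCA (nr phi)).
Qed.

Lemma kato_dual_chain (phi : boundedOp Y (Cplx R)) : (forall x, phi (D x) = 0) ->
  exists (f : nat -> boundedOp Y (Cplx R)) (K C : R),
  [/\ 0 < C, geo_bound K C f, f 0%N = phi & forall n x, f n.+1 (D x) = f n x].
Proof.
have [C C0 hC] := kato_dual_lift; move=> phiD.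
have /choice[g hg] : forall h : boundedOp Y (Cplx R),
    exists psi : boundedOp Y (Cplx R), (forall x, D x = 0 -> h x = 0) ->
    (forall x, psi (D x) = h x) /\ nr psi <= C * nr h.
  move=> h; have [hD|] := pselect (forall x, D x = 0 -> h x = 0); last by exists 0.
  by have [psi ? ?] := hC h hD; exists psi.
pose f n := iter n g phi.
(* [f n] kills the range of [D^(n+1)], which contains the kernel of [D], so it can be lifted once
   more. *)
have fP n : (forall x, f n ((D ^+ n.+1) x) = 0) /\ (forall x, D x = 0 -> f n x = 0).
  elim: n => [|n [IH1 IH2]].
    split=> [x|x Dx]; first by rewrite expr1 phiD.
    by have [w _ <-] := kD.2 1%N x Dx; rewrite expr1 phiD.
  have fS x : f n.+1 ((D ^+ n.+2) x) = 0.
    by rewrite exprS mul_bopE (proj1 (hg _ IH2)) IH1.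
  by split=> // x Dx; have [w _ <-] := kD.2 n.+2 x Dx.
exists f, (nr phi), C; split=> // [n|n x].
  elim: n => [|n IH]; first by rewrite expr0 mulr1.
  rewrite exprS mulrCA (le_trans (proj2 (hg _ (proj2 (fP n)))))//.
  by rewrite ler_wpM2l// ltW.
exact: (proj1 (hg _ (proj2 (fP n)))).
Qed.

End Kato.

(** The functional reads the coefficient [t] on [G] plus the line of [v]; its bound is the inverse
    of a radius [d] of a ball around [v] that misses [G]. *)
Lemma separating_functional {R : realType} (V : normedModType R[i]) (G : set V)
    (v : V) : closed G -> G 0 ->
  (forall (a : R[i]) x y, G x -> G y -> G (a *: x + y)) -> ~ G v ->
  exists2 phi : boundedOp V (Cplx R), (forall x, G x -> phi x = 0) & phi v = 1.
Proof.
move=> cG G0 GP nGv.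
have GD x y : G x -> G y -> G (x + y).
  by move=> Gx Gy; rewrite -[x]scale1r; exact: GP.
have GZ (a : R[i]) x : G x -> G (a *: x).
  by move=> Gx; rewrite -[_ *: _]addr0; exact: GP.
have [d d0 hd] : exists2 d : R, 0 < d & forall x, nr (x - v) < d -> ~ G x.
  by apply/nr_nearP; apply: open_nbhs_nbhs; split=> //; exact: closed_openC.
(* If [nr x < d * nr t], then [v - t^-1 x] would be a point of [G] too close to [v]. *)
have tbound x (t : R[i]) : G (x - t *: v) -> nr (t : Cplx R) <= d^-1 * nr x.
  move=> Gx; have [->|t0] := eqVneq t 0.
    by rewrite nr0 mulr_ge0 ?nr_ge0// invr_ge0 ltW.
  rewrite ler_pdivlMl// leNgt; apply/negP => xt.
  apply: (hd (- (t^-1 *: (x - t *: v)))).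
    rewrite scalerBr scalerA mulVf// scale1r opprB addrAC subrr add0r nrN nrZ.
    have nt : 0 < nr (t : Cplx R) by exact: nr_gt0.
    have -> : nr (t^-1 : Cplx R) = (nr (t : Cplx R))^-1.
      apply: (mulfI (lt0r_neq0 nt)); rewrite mulfV ?gt_eqF//.
      by rewrite -nrZ -[_ *: _]/(t * t^-1) divff// (nr_real 1) normr1.
    by rewrite ltr_pdivrMl// mulrC.
  by rewrite -scaleN1r; exact/GZ/GZ.
have tuniq x (t s : R[i]) : G (x - t *: v) -> G (x - s *: v) -> t = s.
  move=> Gt Gs; apply/eqP; rewrite -subr_eq0; apply/eqP.
  apply: (@nr0_eq0 _ (Cplx R)); apply/eqP; rewrite eq_le nr_ge0 andbT.
  rewrite -(mulr0 d^-1) -(nr0 V) tbound// sub0r -scaleNr opprB scalerBl.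
  have -> : s *: v - t *: v = (x - t *: v) + (-1) *: (x - s *: v).
    by rewrite scaleN1r opprB [RHS]addrC subrKA.
  by apply: GD => //; exact: GZ.
have /choice[t ht] : forall x, exists t : R[i],
    (exists s : R[i], G (x - s *: v)) -> G (x - t *: v).
  move=> x; have [[s Gs]|] := pselect (exists s : R[i], G (x - s *: v)).
    by exists s.
  by exists 0.
have [||||phi phiE _] := @hahn_banach R V [set x | exists s : R[i], G (x - s *: v)]
    (t : V -> Cplx R) d^-1.
- by exists 0; rewrite scale0r subr0.
- move=> a x y Gx Gy; have Gax : G (a *: x + y - (a * t x + t y) *: v).
    have -> : a *: x + y - (a * t x + t y) *: v =
        a *: (x - t x *: v) + (y - t y *: v).
      by rewrite scalerBr scalerA scalerDl opprD addrACA.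
    by apply: GP; exact: ht.
  split; first by exists (a * t x + t y).
  by apply: (tuniq (a *: x + y)) => //; apply: ht; exists (a * t x + t y).
- by move=> x Gx; apply: tbound; exact: ht.
- by rewrite invr_ge0 ltW.
exists phi => [x Gx|].
  have Gx0 : G (x - 0 *: v) by rewrite scale0r subr0.
  by rewrite phiE; [apply: (tuniq x) => //; apply: ht|]; exists 0.
have Gv : G (v - 1 *: v) by rewrite scale1r subrr.
by rewrite phiE; [apply: (tuniq v) => //; apply: ht|]; exists 1.
Qed.

(** * Small scalar perturbations, and ranges under the Drazin condition *)

Section Perturbation.
Context {R : realType} (Y : normedModType R[i]) (cY : seq_complete Y).
Implicit Types (A B D : boundedOp Y Y).

(** The solution is the Neumann-type series of [mu^n g^(n+1) y], where [g] need not be linear since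
    only [D (g y) = y] is used on its terms. *)
Lemma surjective_sub_scalar D C (g : Y -> Y) (mu : Cplx R) : 0 < C ->
  (forall y, D (g y) = y /\ nr (g y) <= C * nr y) -> nr mu * C < 1 ->
  forall y, exists x, sub_scalar D mu x = y.
Proof.
move=> C0 hg muC y.
have xK : geo_bound (C * nr y) C (fun n => iter n.+1 g y).
  elim=> [|n IH]; first by rewrite expr0 mulr1; exact: (proj2 (hg y)).
  by rewrite iterS exprS mulrCA (le_trans (proj2 (hg _)))// ler_wpM2l// ltW.
exists (psum (fun n => iter n.+1 g y) mu).
rewrite sub_scalarE (psum_op cY (ltW C0) xK muC) => [|n] /=.
  exact: (proj1 (hg y)).
exact: (proj1 (hg _)).
Qed.

Definition bounded_below D := exists2 C : R, 0 < C & forall x, nr x <= C * nr (D x).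

Lemma bounded_below_exp D n : bounded_below D -> bounded_below (D ^+ n).
Proof.
move=> [C C0 hC]; exists (C ^+ n); first exact: exprn_gt0.
elim: n => [|n IH] x; first by rewrite expr0 mul1r expr0 one_bopE.
rewrite exprSr (le_trans (hC x))// -mulrA mulrCA ler_wpM2l ?(ltW C0)//.
by rewrite exprSr mul_bopE.
Qed.

Lemma bounded_below_closed D : bounded_below D -> closed (range D).
Proof.
move=> [C C0 hC]; apply/closed_seqP => u l uD ul.
have /choice[x hx] : forall n, exists x, D x = u n.
  by move=> n; have [x _ <-] := uD n; exists x.
have [k xk] : exists k : Y, x @ \oo --> k.
  apply: cY => e e0; have e2 : 0 < e / (2 * C) by rewrite divr_gt0// mulr_gt0.
  have [N hN] := (cvg_nrP _ _).1 ul _ e2.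
  exists N => n m Nn Nm; apply: (le_lt_trans (hC _)).
  rewrite linearB /= !hx; have := ler_nr_distD l (u n) (u m).
  have := hN n Nn; have := hN m Nm; rewrite !ltr_pdivlMr ?mulr_gt0//.
  by rewrite (nr_distC (u m)); nra.
exists k => //; apply: (cvgn_unique (cvg_bop D xk)).
by rewrite (_ : (fun n => _) = u)//; apply/funext => n.
Qed.

Lemma bounded_below_inj D x : bounded_below D -> D x = 0 -> x = 0.
Proof.
move=> [C _ hC] Dx; apply/nr0_eq0/eqP.
by rewrite eq_le nr_ge0 andbT (le_trans (hC x))// Dx nr0 mulr0.
Qed.

Lemma bounded_below_sub_scalar D C (mu : Cplx R) : 0 < C ->
  (forall x, nr x <= C * nr (D x)) -> nr mu * C <= 2^-1 ->
  bounded_below (sub_scalar D mu).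
Proof.
move=> C0 hC muC; exists (2 * C); first by rewrite mulr_gt0.
move=> x; have := hC x; have := ler_nrD (sub_scalar D mu x) ((mu : R[i]) *: x).
rewrite sub_scalarE subrK nrZ => h1 h2.
have : C * nr (D x) <= C * (nr (D x - (mu : R[i]) *: x) + nr mu * nr x).
  by rewrite ler_wpM2l// ltW.
have : C * (nr mu * nr x) <= 2^-1 * nr x.
  by rewrite mulrA (mulrC C) ler_wpM2r// nr_ge0.
by rewrite mulrDr; lra.
Qed.

Section Drazin.
Variables (A b : boundedOp Y Y) (k : nat).
Hypothesis bA : b * A = A * b.
Hypothesis Ab : forall v, (A ^+ k.+1) (b v) = (A ^+ k) v.

Lemma drazin_bX n v : b ((A ^+ n) v) = (A ^+ n) (b v).
Proof.
elim: n v => [|n IH] v; first by rewrite !expr0.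
by rewrite !exprS !mul_bopE -IH -!mul_bopE bA.
Qed.

Lemma drazin_exp i v : (A ^+ (k + i)%N) ((b ^+ i) v) = (A ^+ k) v.
Proof.
elim: i v => [|i IH] v; first by rewrite addn0 expr0.
by rewrite addnS -addSn addnC exprD (exprS b) !mul_bopE Ab -mul_bopE -exprD addnC IH.
Qed.

Lemma drazin_inj v : (A ^+ k.+1) v = 0 -> (A ^+ k) v = 0.
Proof. by move=> Av; rewrite -Ab -drazin_bX Av linear0. Qed.

Lemma drazin_range v : range (A ^+ k) v -> range (A ^+ k.+1) v.
Proof. by move=> [w _ <-]; exists (b w). Qed.

(** The range of [A^k] is the set of fixed points of the bounded operator [A^k b^k]. *)
Lemma drazin_closed : closed (range (A ^+ k)).
Proof.
have h w : range (A ^+ k) w <-> (A ^+ k) ((b ^+ k) w) = w.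
  split=> [[v _ <-]|<-]; last by eexists.
  have bX j u : (b ^+ j) ((A ^+ k) u) = (A ^+ k) ((b ^+ j) u).
    elim: j u => [|j IH] u; first by rewrite !expr0.
    by rewrite !exprSr !mul_bopE drazin_bX IH.
  by rewrite bX -mul_bopE -exprD drazin_exp.
apply/closed_seqP => u l uA ul; apply/h.
apply: (cvgn_unique (cvg_bop (A ^+ k) (cvg_bop (b ^+ k) ul))).
rewrite (_ : (fun n => _) = u)//.
by apply/funext => n; have /h := uA n.
Qed.

End Drazin.

End Perturbation.

(** * Browder properties of the restriction to the range of a power *)

Section BBrowder.
Context {R : realType} (X : normedModType R[i]) (A : boundedOp X X) (k : nat).

Let D := restr_range A k.

(** The restriction is injective, so its ascent is 0, and its range is that of [A^(k+1)]. *)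
Lemma upper_semi_Browder_restr : closed (range (A ^+ k.+1)) ->
  (forall x, (A ^+ k.+1) x = 0 -> (A ^+ k) x = 0) -> upper_semi_Browder D.
Proof.
move=> cA injA.
have injD x : D x = 0 -> x = 0.
  move=> /(congr1 (@sub_val _ _ _)) /= Dx; apply: val_inj => /=.
  have /asboolP[y _ yx] := sub_valP x.
  by rewrite -yx injA// exprS mul_bopE yx.
split; first split.
- exists 0%N, (fun=> 0) => x /injD ->; exists (fun=> 0).
  by rewrite big_ord0.
- apply/closed_seqP => u l uD ul.
  have [y _ yl] : range (A ^+ k.+1) (sub_val l).
    apply: ((closed_seqP _).1 cA (fun n => sub_val (u n))).
      move=> n; have [x _ <-] := uD n; have /asboolP[y _ yx] := sub_valP x.
      by exists y => //=; rewrite exprS mul_bopE yx.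
    by apply/cvg_nrP; move/cvg_nrP: ul.
  have Ay : (A ^+ k) y \in range_pred (A ^+ k) by apply/asboolP; exists y.
  exists (SubspaceOf Ay) => //; apply: val_inj => /=.
  by rewrite -yl exprS mul_bopE.
- exists 0%N; apply/seteqP; split=> x xD.
    have -> : x = 0 by exact: xD.
    exact: linear0.
  by have -> : x = 0 by exact: injD.
Qed.

(** The restriction is onto, so its codimension and descent are 0. *)
Lemma lower_semi_Browder_restr :
  (forall x, range (A ^+ k) x -> range (A ^+ k.+1) x) -> lower_semi_Browder D.
Proof.
move=> hA.
have surjD x : range D x.
  have /asboolP/hA[y _ yx] := sub_valP x.
  have Ay : (A ^+ k) y \in range_pred (A ^+ k) by apply/asboolP; exists y.
  exists (SubspaceOf Ay) => //; apply: val_inj => /=.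
  by rewrite -[RHS]yx exprS mul_bopE.
split.
  exists 0%N, (fun=> 0) => x; exists (fun=> 0).
  by rewrite big_ord0 subr0; exact: surjD.
exists 0%N; apply/seteqP; split=> x _; rewrite ?expr1; first exact: surjD.
by exists x; rewrite ?expr0.
Qed.

End BBrowder.

(** * Direct sums and the conclusion *)

(** Injectivity of [E] makes the chosen solution unique, hence linear. *)
Lemma bounded_lift {R : realType} (U V W : normedModType R[i])
    (E : boundedOp U W) (F : boundedOp V W) (C : R) :
  (forall x, exists2 y, E y = F x & nr y <= C * nr x) ->
  (forall y, E y = 0 -> y = 0) ->
  exists G : boundedOp V U, forall x, E (G x) = F x.
Proof.
move=> hE injE.
have /choice[g hg] : forall x, exists y, E y = F x /\ nr y <= C * nr x.
  by move=> x; have [y ? ?] := hE x; exists y.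
have lg : linear g.
  move=> a x y; apply/eqP; rewrite -subr_eq0; apply/eqP/injE.
  by rewrite linearB linearP /= (hg _).1 (hg x).1 (hg y).1 linearP subrr.
have [G GE] := @linear_bounded_op _ _ _ g C lg (fun x => (hg x).2).
by exists G => x; rewrite GE (hg x).1.
Qed.

Section Reduction.
Context {R : realType} (X : completeNormedModType R[i]).
Variables (T : boundedOp X X) (M N : submodClosed X).
Hypothesis MN : Red T M N.

Lemma red_direct (y y' : subspaceOf M) (z z' : subspaceOf N) :
  sub_val y + sub_val z = sub_val y' + sub_val z' -> y = y' /\ z = z'.
Proof.
move=> e.
have e' : sub_val (y - y') = sub_val (z' - z).
  apply/eqP; rewrite -[sub_val (y - y')]/(sub_val y - sub_val y').
  rewrite -[sub_val (z' - z)]/(sub_val z' - sub_val z).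
  by rewrite subr_eq addrAC eq_sym subr_eq [sub_val z' + _]addrC e.
have y0 : sub_val (y - y') = 0.
  by apply: (red_cap MN); [|rewrite e']; exact: sub_valP.
split; apply/eqP; [|rewrite eq_sym]; rewrite -subr_eq0; apply/eqP/val_inj.
  exact: y0.
by rewrite -[LHS]/(sub_val (z' - z)) -e' y0.
Qed.

(** Addition from the product of [M] and [N] to [X] is a bounded bijection of complete spaces; the
    open mapping theorem bounds its inverse. *)
Lemma red_projections : exists (P : boundedOp X (subspaceOf M))
  (Q : boundedOp X (subspaceOf N)), forall x, x = sub_val (P x) + sub_val (Q x).
Proof.
have cX := @seq_complete_banach R X.
pose f (u : subspaceOf M * subspaceOf N) : X := sub_val u.1 + sub_val u.2.
have lf : linear f.
  by move=> a u v; rewrite /f /= scalerDr addrACA.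
have fC u : nr (f u) <= 2 * nr u.
  rewrite (le_trans (ler_nrD _ _))// nr_pair.
  have : nr (sub_val u.1) <= Num.max (nr u.1) (nr u.2) by rewrite le_max lexx.
  have : nr (sub_val u.2) <= Num.max (nr u.1) (nr u.2) by rewrite le_max lexx orbT.
  by lra.
have [F FE] := linear_bounded_op lf fC.
have surjF x : range F x.
  have [y [z [yM zN ->]]] := red_sum MN x.
  by exists (SubspaceOf yM, SubspaceOf zN); rewrite ?FE.
have cF : closed (range F).
  by rewrite (_ : range F = setT); [exact: closedT|apply/seteqP; split].
have [C C0 hC] := open_mapping
  (seq_complete_prod (seq_complete_sub cX (red_closedl MN))
    (seq_complete_sub cX (red_closedr MN))) cX cF.
have [|u|G GE] := @bounded_lift R _ X X F 1 C.
- by move=> x; exact: hC.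
- rewrite FE => u0; case: u u0 => y z /= yz.
  have [-> ->] // : y = 0 /\ z = 0.
  by apply: red_direct; rewrite -[LHS]/(f (y, z)) yz /= addr0.
have lP : linear (fun x => (G x).1) by move=> a x y; rewrite linearP.
have lQ : linear (fun x => (G x).2) by move=> a x y; rewrite linearP.
have [CG CG0 hG] := bounded_op_nr G.
have hP x : nr (G x).1 <= CG * nr x.
  by apply: le_trans (hG x); rewrite nr_pair le_max lexx.
have hQ x : nr (G x).2 <= CG * nr x.
  by apply: le_trans (hG x); rewrite nr_pair le_max lexx orbT.
have [P PE] := linear_bounded_op lP hP.
have [Q QE] := linear_bounded_op lQ hQ.
by exists P, Q => x; rewrite PE QE; have := GE x; rewrite FE /f => ->.
Qed.

End Reduction.

(* [X] is identified with [Y x Z] through the jointly bijective pair [(P, Q)],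
   which turns [A] into the direct sum of [B] and [C]. *)
Section DirectSum.
Context {R : realType} (X Y Z : normedModType R[i]).
Variables (P : boundedOp X Y) (Q : boundedOp X Z).
Variables (A : boundedOp X X) (B : boundedOp Y Y) (C : boundedOp Z Z).
Hypothesis PQ_inj : forall x, P x = 0 -> Q x = 0 -> x = 0.
Hypothesis PQ_surj : forall y z, exists x, P x = y /\ Q x = z.
Hypothesis PA : forall x, P (A x) = B (P x).
Hypothesis QA : forall x, Q (A x) = C (Q x).

Lemma PAX n x : P ((A ^+ n) x) = (B ^+ n) (P x).
Proof. by elim: n x => [|n IH] x; rewrite ?expr0// !exprS !mul_bopE PA IH. Qed.

Lemma QAX n x : Q ((A ^+ n) x) = (C ^+ n) (Q x).
Proof. by elim: n x => [|n IH] x; rewrite ?expr0// !exprS !mul_bopE QA IH. Qed.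

Lemma range_direct_sum n x :
  range (A ^+ n) x <-> range (B ^+ n) (P x) /\ range (C ^+ n) (Q x).
Proof.
split=> [[w _ <-]|[[y _ yx] [z _ zx]]].
  by rewrite PAX QAX; split; [exists (P w)|exists (Q w)].
have [w [Pw Qw]] := PQ_surj y z; exists w => //.
apply/eqP; rewrite -subr_eq0; apply/eqP/PQ_inj.
  by rewrite linearB /= PAX Pw yx subrr.
by rewrite linearB /= QAX Qw zx subrr.
Qed.

Lemma closed_direct_sum n : closed (range (B ^+ n)) -> closed (range (C ^+ n)) ->
  closed (range (A ^+ n)).
Proof.
move=> /closed_seqP cB /closed_seqP cC; apply/closed_seqP => u l uA ul.
apply/range_direct_sum; split.
  by apply: cB (cvg_bop P ul) => n'; have /range_direct_sum[] := uA n'.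
by apply: cC (cvg_bop Q ul) => n'; have /range_direct_sum[] := uA n'.
Qed.

Variables (b : boundedOp Z Z) (k : nat).
Hypothesis bC : b * C = C * b.
Hypothesis Cb : forall v, (C ^+ k.+1) (b v) = (C ^+ k) v.

(** One index higher, so that [drazin_closed] also covers the range of [C^(k+1)]. *)
Let Cb1 v : (C ^+ k.+2) (b v) = (C ^+ k.+1) v.
Proof. by rewrite exprS mul_bopE Cb -mul_bopE -exprS. Qed.

Lemma direct_sum_upper : seq_complete Y -> bounded_below B ->
  closed (range (A ^+ k)) /\ upper_semi_Browder (restr_range A k).
Proof.
move=> cY hB.
have cB n : closed (range (B ^+ n)).
  exact/(bounded_below_closed cY)/bounded_below_exp.
split; first exact: closed_direct_sum (cB k) (drazin_closed bC Cb).
apply: upper_semi_Browder_restr.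
  exact: closed_direct_sum (cB _) (drazin_closed bC Cb1).
move=> x Ax; apply: PQ_inj.
  rewrite PAX; apply: (bounded_below_inj hB).
  by rewrite -mul_bopE -exprS -PAX Ax linear0.
by rewrite QAX; apply: (drazin_inj bC Cb); rewrite -QAX Ax linear0.
Qed.

Lemma direct_sum_lower : (forall y, exists x, B x = y) ->
  closed (range (A ^+ k)) /\ lower_semi_Browder (restr_range A k).
Proof.
move=> hB.
have rB n y : range (B ^+ n) y.
  elim: n y => [|n IH] y; first by exists y; rewrite ?expr0.
  have [x <-] := hB y; have [w _ <-] := IH x.
  by exists w => //; rewrite exprS mul_bopE.
split.
  apply: closed_direct_sum; last exact: drazin_closed bC Cb.
  by rewrite (_ : range _ = setT); [exact: closedT|apply/seteqP; split].
apply: lower_semi_Browder_restr => x /range_direct_sum[_ Qx].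
by apply/range_direct_sum; split; [exact: rB|exact: (drazin_range Cb)].
Qed.

End DirectSum.

(** * The SVEP near a point with a generalized Kato-meromorphic decomposition *)

Section GenKatoMeromorphic.
Context {R : realType} (X : completeNormedModType R[i]).
Variables (T : boundedOp X X) (p : Cplx R).

Let cX := @seq_complete_banach R X.

Section KatoPart.
Variables (M : submodClosed X) (TM : op_invariant (sub_scalar T p) M).
Let D := restr TM.
Hypothesis kD : Kato D.
Hypothesis cM : seq_complete (subspaceOf M).

(** The backward orbit of a kernel vector in [M] is also one in [X], where [SVEP_chain] applies. *)
Lemma SVEP_kato_injective : SVEP T -> forall y, D y = 0 -> y = 0.
Proof.
move=> svepT y Dy.
have [x [K [C [C0 xK x0 Dx]]]] := kato_chain cM kD Dy.
apply: val_inj; rewrite -x0.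
apply: (SVEP_chain cX (svepT p) (x := fun n => sub_val (x n)) C0 xK).
  by rewrite x0 -[LHS]/(sub_val (D y)) Dy.
by move=> n; rewrite -[LHS]/(sub_val (D (x n.+1))) Dx.
Qed.

(** A functional separating [y] from the range starts a chain of functionals on [M]. Composition
    with the intertwining [P] carries it to the dual of [X], where the SVEP annihilates it; as [P]
    is onto, this contradicts [phi y = 1]. *)
Lemma SVEP_dual_kato_surjective (P : boundedOp X (subspaceOf M)) :
  (forall x, P (sub_scalar T p x) = D (P x)) ->
  (forall y, exists x, P x = y) ->
  SVEP (dual_op T) -> forall y, range D y.
Proof.
move=> PD surjP svepT y; apply: contrapT => nDy.
have [||phi phiD phiy] := separating_functional kD.1 _ _ nDy.
- by exists 0; rewrite ?linear0.
- by move=> a _ _ [u _ <-] [v _ <-]; exists (a *: u + v); rewrite ?linearP.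
have [|f [K [C [C0 fK f0 fD]]]] := kato_dual_chain cM kD (phi := phi).
  by move=> x; apply: phiD; exists x.
have [CP CP0 hP] := bounded_op_nr P.
have fPK : geo_bound (K * CP) C (fun n => bop_comp (f n) P).
  move=> n; have K0 := geo_bound_ge0 fK.
  apply: nr_bop_le => [|x]; first by rewrite !mulr_ge0// ?exprn_ge0// ltW.
  rewrite (le_trans (nr_bop (f n) (P x)))//.
  have -> : K * CP * C ^+ n * nr x = (K * C ^+ n) * (CP * nr x) by ring.
  by apply: ler_pM; rewrite ?nr_ge0.
have dualE g x : sub_scalar (dual_op T) p (bop_comp g P) x = g (D (P x)).
  rewrite -PD sub_scalarE [P _]linearB /= [P (_ *: _)]linearZ.
  by rewrite [RHS]linearB [X in _ = _ - X]linearZ.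
have cX' := @seq_complete_bop R X _ (@seq_complete_complex R).
have /(congr1 (fun h : boundedOp _ _ => h _)) fP0 : bop_comp (f 0%N) P = 0.
  apply: (SVEP_chain cX' (svepT p) C0 fPK) => [|n]; apply: boundedOpP => x.
    by rewrite dualE f0; apply: phiD; exists (P x).
  by rewrite dualE fD.
have [x Px] := surjP y; have /eqP := fP0 x.
by rewrite /= f0 Px phiy oner_eq0.
Qed.

End KatoPart.

(** The same exponent [k] serves both conclusions, so that they can be combined into the B-Browder
    property. *)
Lemma gen_Kato_meromorphic_near : gen_Kato_meromorphic (sub_scalar T p) ->
  exists2 d : R, 0 < d & forall l : Cplx R, l != p -> nr (l - p) < d ->
  exists k, let A := sub_scalar T l in
    (SVEP T -> closed (range (A ^+ k)) /\ upper_semi_Browder (restr_range A k)) /\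
    (SVEP (dual_op T) ->
     closed (range (A ^+ k)) /\ lower_semi_Browder (restr_range A k)).
Proof.
move=> [M [N [MN [kM mN]]]].
set D := restr _ in kM; set E := restr _ in mN.
have cM := seq_complete_sub cX (red_closedl MN).
have cN := seq_complete_sub cX (red_closedr MN).
have [P [Q PQ]] := red_projections MN.
have PQS x : P (sub_scalar T p x) = D (P x) /\ Q (sub_scalar T p x) = E (Q x).
  by apply: (red_direct MN); rewrite -PQ {1}(PQ x) linearD.
have PQ_inj x : P x = 0 -> Q x = 0 -> x = 0.
  by move=> Px Qx; rewrite (PQ x) Px Qx addr0.
have PQ_surj y z : exists x, P x = y /\ Q x = z.
  by exists (sub_val y + sub_val z); apply: (red_direct MN); rewrite -PQ.
have [C C0 [g hg]] := kato_open cM kM.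
(* This radius gives [nr (l - p) * C <= 2^-1], which suits both perturbation lemmas. *)
exists (2 * C)^-1 => [|l lp ld]; first by rewrite invr_gt0 mulr_gt0.
have mu0 : l - p != 0 by rewrite subr_eq0.
have [k [b [bE Eb]]] := meromorphic_drazin cN mN mu0.
have muC : nr (l - p) * C <= 2^-1.
  have -> : 2^-1 = (2 * C)^-1 * C by field; rewrite gt_eqF.
  by rewrite ler_wpM2r// ltW.
have lE x : sub_scalar T l x = sub_scalar T p x - (l - p : R[i]) *: x.
  by rewrite !sub_scalarE scalerBl opprB addrA subrK.
have PA x : P (sub_scalar T l x) = sub_scalar D (l - p) (P x).
  by rewrite lE linearB linearZ /= (PQS x).1.
have QA x : Q (sub_scalar T l x) = sub_scalar E (l - p) (Q x).
  by rewrite lE linearB linearZ /= (PQS x).2.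
exists k; split=> svepT.
  apply: (direct_sum_upper PQ_inj PQ_surj PA QA bE Eb cM).
  apply: (bounded_below_sub_scalar C0 _ muC) => x.
  have [Dg gC] := hg (D x) (ex_intro2 _ _ x I erefl).
  (* Once [D] is injective, [g] inverts it, and the bound on [g] says that [D] is bounded below. *)
  suff gx : g (D x) = x by rewrite -{1}gx.
  apply/eqP; rewrite -subr_eq0; apply/eqP.
  apply: (SVEP_kato_injective kM cM svepT).
  by rewrite linearB; apply/eqP; rewrite subr_eq0; apply/eqP; exact: Dg.
apply: (direct_sum_lower PQ_inj PQ_surj PA QA bE Eb).
apply: (surjective_sub_scalar cM C0 (g := g) (D := D)) => [y|].
  apply: hg; apply: (SVEP_dual_kato_surjective kM cM (P := P)) => //.
    by move=> x; rewrite (PQS x).1.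
  by move=> y'; have [x []] := PQ_surj y' 0; exists x.
by lra.
Qed.

End GenKatoMeromorphic.

Lemma limit_point_sub {R : realType} (X : completeNormedModType R[i])
    (T : boundedOp X X) (E : set (Cplx R)) :
  (forall p, gen_Kato_meromorphic (sub_scalar T p) ->
     exists2 d : R, 0 < d & forall l, l != p -> nr (l - p) < d -> ~ E l) ->
  limit_point E `<=` sigma_gKM T.
Proof.
move=> hE p pE gK; have [d d0 hd] := hE p gK.
have [|l [lp lE ld]] := pE (fun l => nr (l - p) < d).
  by apply: (nr_nearP p _).2; exists d.
exact: (hd l).
Qed.

Theorem corollary3p4 (R : realType) (X : completeNormedModType R[i])
    (infX : ~ finite_dim [set: X]) (T : boundedOp X X) :
  [/\ SVEP T -> limit_point (sigma_BBp T) `<=` sigma_gKM T,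
      SVEP (dual_op T) -> limit_point (sigma_BBm T) `<=` sigma_gKM T
    & SVEP T -> SVEP (dual_op T) ->
      limit_point (sigma_BB T) `<=` sigma_gKM T].
Proof.
split=> [sT|sT'|sT sT']; apply: limit_point_sub
  => p /gen_Kato_meromorphic_near[d d0 hd];
  exists d => // l lp ld; have [k [hu hl]] := hd l lp ld; apply.
- by exists k; exact: hu.
- by exists k; exact: hl.
- by have [? ?] := hu sT; have [? ?] := hl sT'; exists k.
Qed.
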